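(* Let $T$ be a complete theory (with infinite models) over a finite binary relational vocabulary. The following are equivalent. (i) $T$ is strongly minimal and $\omega$-categorical with trivial algebraic closure. (ii) There is a restricted equivalence relation $\xi$ for $T$ with only one infinite equivalence class in $\mathcal{M}\models T$ such that $T$ satisfies $\xi$-extension properties and all pairs of (distinct) elements which are not from the base sets have the same atomic diagram. (iii) If $\mathcal{M}\models T$, there exists a cofinite $\emptyset$-definable set which is indiscernible over the rest of $\mathcal{M}$.
   Context: A vocabulary is binary if it contains only relation symbols of arity at most $2$. A theory is $\omega$-categorical if it has a unique countable model up to isomorphism (no finite models, exactly one countably infinite one). $T$ is strongly minimal if for each $\mathcal{M}\models T$, formula $\varphi(x,\bar y)$ and tuple $\bar a\in M$, $\varphi(\mathcal{M},\bar a)$ or $\neg\varphi(\mathcal{M},\bar a)$ is finite. The algebraic closure is trivial if $\mathrm{acl}(X)=X\cup\mathrm{acl}(\emptyset)$ for all $X\subseteq M$, $\mathcal{M}\models T$. Indiscernible means indiscernible as a set. $[n]=\{1,\dots,n\}$; $\mathrm{atDiag}$ denotes atomic diagram (including equalities and inequalities); a binary atomic diagram is the atomic diagram of a pair. Restricted equivalence relation: a formula $\xi(x,y)$ is a restricted equivalence relation for $T$ if for some $k,t\in\mathbb{N}$, $T$ implies that $\xi$ defines an equivalence relation with $k+t$ classes, $k$ of them infinite and $t$ of size $1$. The classes of size $1$ are called base sets. Extension properties: $T$ satisfies extension properties with extension axioms $\theta_{k,i}(x_1,\dots,x_k)$, $k\in\mathbb{Z}^+$, $i\in[i_k]$, if: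 (1) $T\models\forall\bar x(\bigwedge_{i<j}x_i\ne x_j\rightarrow\bigvee_{n=1}^{i_k}\theta_{k,n}(\bar x))$ for each $k$; (2) for each $k$ and $i\in[i_k]$ there is a non-empty set $J_{k,i}\subseteq[i_{k+1}]$ of associated numbers with $T\models\forall\bar x(\theta_{k,i}(\bar x)\rightarrow\exists z\,\theta_{k+1,j}(\bar x,z))$ for all $j\in J_{k,i}$ and $T\models\forall\bar x(\theta_{k,i}(\bar x)\rightarrow\forall y(\bigwedge_n y\ne x_n\rightarrow\bigvee_{j\in J_{k,i}}\theta_{k+1,j}(\bar x,y)))$, and $T\models\exists z\,\theta_{1,j}(z)$ for all $j\in[i_1]$; (3) $T\models\forall\bar x(\theta_{k,i}(\bar x)\rightarrow\bigwedge_{\alpha<\beta}x_\alpha\ne x_\beta)$; (4) for each $k$, $i$ there is an atomic diagram $R$ with $T\models\forall\bar x(\theta_{k,i}(\bar x)\rightarrow R(\bar x))$. $(\xi,\Delta)$-extension axioms: let $\xi(x,y)$ be a formula, $l\in\mathbb{N}$, and $\Delta=\{\delta_{i,j}\}_{i,j\in[l]}$ with each $\delta_{i,j}$ a non-empty set of binary atomic diagrams. Let $\gamma$ be a sentence $\exists x_{1,1},\dots,x_{1,t_1},\dots,x_{l,1},\dots,x_{l,t_l}\,\gamma_0$ where $\gamma_0$ implies that for all $i,j\in[l]$, $\{\mathrm{atDiag}(x_{i,\alpha},x_{j,\beta}):\alpha\in[t_i],\beta\in[t_j]\}=\delta_{i,j}$, and that $\xi(x_{i,\alpha},x_{j,\beta})$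 holds iff $i=j$. For each $k$, each $j_1,\dots,j_k\in[l]$ and each collection $(\eta_{r,s})_{r,s\in[k]}$ with $\eta_{r,s}\in\delta_{j_r,j_s}$ that is jointly satisfiable by $k$ distinct elements, there is an index $j\in[i_k]$ and a formula $\theta'_{k,j}(y_1,\dots,y_k,x_{1,1},\dots,x_{l,t_l})$ expressing that for all $r,s\in[k]$, $\mathrm{atDiag}(y_r,y_s)=\eta_{r,s}$ and $\xi(y_r,x_{j_r,1})$; all indices in $[i_k]$ arise this way. The formulas $\theta_{k,j}(y_1,\dots,y_k):=\exists x_{1,1},\dots,x_{l,t_l}(\gamma_0\wedge\theta'_{k,j})$ are $(\xi,\Delta)$-extension axioms. $T$ satisfies $(\xi,\Delta)$-extension properties if $T$ implies that $\xi$ is a restricted equivalence relation with $l$ classes and $T$ satisfies extension properties using the $(\xi,\Delta)$-extension axioms, with $j$ associated to $(k,i)$ when $\theta'_{k,i}$ is a subformula of $\theta'_{k+1,j}$ (i.e. the class indices and diagrams of $\theta'_{k+1,j}$ extend those of $\theta'_{k,i}$). $T$ satisfies $\xi$-extension properties if it satisfies $(\xi,\Delta)$-extension properties for some $\Delta$. *)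

(* Defs.v *)
From mathcomp Require Import all_boot.
From mathcomp Require Import order.
From mathcomp Require Import boolp classical_sets functions cardinality.

Set Implicit Arguments.
Unset Strict Implicit.
Unset Printing Implicit Defensive.

Local Open Scope classical_set_scope.
Local Open Scope card_scope.

Record vocabulary := Vocabulary {
  symbol : finType;
  arity : symbol -> nat
}.
Arguments arity {v} _.

Definition binary (L : vocabulary) : Prop := forall r : symbol L, arity r <= 2.

Record structure (L : vocabulary) := Structure {
  carrier :> Type;
  interp : forall r : symbol L, (arity r).-tuple carrier -> Prop;
  structure_inhabited : inhabited carrier
}.
Arguments interp {L} M r _ : rename.

(* Atomic formulas in n variables: inl (i, j) is the equation x_i = x_j and
   inr (existT r v) is r(x_(v_0), x_(v_1), ...). *)
Definition atomic (L : vocabulary) (n : nat) : finType :=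
  ('I_n * 'I_n + {r : symbol L & (arity r).-tuple 'I_n})%type.

(* Well-scoped de Bruijn syntax: [formula L n] has its free variables among
   x_0, ..., x_(n-1), and [Ex] binds x_0 of its body. *)
Inductive formula (L : vocabulary) : nat -> Type :=
| Atom n : atomic L n -> formula L n
| Not n : formula L n -> formula L n
| And n : formula L n -> formula L n -> formula L n
| Ex n : formula L n.+1 -> formula L n.
Arguments Atom {L n} _.

Definition sat_atomic (L : vocabulary) (M : structure L) n (v : n.-tuple M)
    (a : atomic L n) : Prop :=
  match a with
  | inl (i, j) => tnth v i = tnth v j
  | inr (existT r w) => interp M r [tuple of map (tnth v) w]
  end.

Fixpoint sat (L : vocabulary) (M : structure L) n (phi : formula L n) :
    n.-tuple M -> Prop :=
  match phi with
  | Atom _ a => fun v => sat_atomic v a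
  | Not _ psi => fun v => ~ sat psi v
  | And _ psi chi => fun v => sat psi v /\ sat chi v
  | Ex _ psi => fun v => exists x : M, sat psi [tuple of x :: v]
  end.

Definition lift_renaming m n (f : 'I_m -> 'I_n) (i : 'I_m.+1) : 'I_n.+1 :=
  if unlift ord0 i is Some j then lift ord0 (f j) else ord0.

Definition rename_atomic (L : vocabulary) m n (f : 'I_m -> 'I_n)
    (a : atomic L m) : atomic L n :=
  match a with
  | inl (i, j) => inl (f i, f j)
  | inr (existT r w) =>
      inr (existT (fun r : symbol L => (arity r).-tuple 'I_n) r
                  [tuple of map f w])
  end.

Fixpoint rename (L : vocabulary) m (phi : formula L m) :
    forall n, ('I_m -> 'I_n) -> formula L n :=
  match phi with
  | Atom _ a => fun n f => Atom (rename_atomic f a)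
  | Not _ psi => fun n f => Not (rename psi f)
  | And _ psi chi => fun n f => And (rename psi f) (rename chi f)
  | Ex _ psi => fun n f => Ex (rename psi (lift_renaming f))
  end.

(* Existentially quantifies the first N variables. *)
Fixpoint exs (L : vocabulary) N k : formula L (N + k) -> formula L k :=
  match N with
  | 0 => fun phi => phi
  | N'.+1 => fun phi => exs (Ex phi : formula L (N' + k))
  end.

(* The atomic diagram of a tuple, coded by the atomic formulas true of it;
   those not in the set are the negated ones. *)
Definition diagram (L : vocabulary) (n : nat) : finType := {set atomic L n}.

Definition atDiag (L : vocabulary) (M : structure L) n (v : n.-tuple M) :
    diagram L n :=
  [set a | `[< sat_atomic v a >]]%SET.

Definition is_diagram (L : vocabulary) n (R : diagram L n) : Prop :=
  exists (M : structure L) (v : n.-tuple M), atDiag v = R.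

Definition theory (L : vocabulary) := set (formula L 0).

Definition is_model (L : vocabulary) (T : theory L) (M : structure L) : Prop :=
  forall sigma, T sigma -> sat sigma ([tuple] : 0.-tuple M).

Definition entails (L : vocabulary) (T : theory L) (sigma : formula L 0) :
    Prop :=
  forall M, is_model T M -> sat sigma ([tuple] : 0.-tuple M).

Definition complete (L : vocabulary) (T : theory L) : Prop :=
  (exists M, is_model T M) /\
  forall sigma, entails T sigma \/ entails T (Not sigma).

Definition has_infinite_models (L : vocabulary) (T : theory L) : Prop :=
  exists M : structure L, is_model T M /\ infinite_set [set: M].

Definition isomorphic (L : vocabulary) (M N : structure L) : Prop :=
  exists f : M -> N, bijective f /\
    forall r (v : (arity r).-tuple M),
      interp M r v <-> interp N r [tuple of map f v].

Definition omega_categorical (L : vocabulary) (T : theory L) : Prop :=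
  [/\ forall M : structure L, is_model T M -> infinite_set [set: M],
      exists M : structure L, is_model T M /\ [set: M] #= [set: nat] &
      forall M N : structure L, is_model T M -> is_model T N ->
        [set: M] #= [set: nat] -> [set: N] #= [set: nat] -> isomorphic M N].

Definition defset (L : vocabulary) (M : structure L) n
    (phi : formula L n.+1) (a : n.-tuple M) : set M :=
  [set x | sat phi [tuple of x :: a]].

Definition strongly_minimal (L : vocabulary) (T : theory L) : Prop :=
  forall M : structure L, is_model T M ->
  forall n (phi : formula L n.+1) (a : n.-tuple M),
    finite_set (defset phi a) \/ finite_set (~` defset phi a).

Definition acl (L : vocabulary) (M : structure L) (X : set M) : set M :=
  [set b | exists n (phi : formula L n.+1) (a : n.-tuple M),
    [/\ forall i, X (tnth a i), finite_set (defset phi a) & defset phi a b]].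

Definition trivial_acl (L : vocabulary) (T : theory L) : Prop :=
  forall M : structure L, is_model T M ->
  forall X : set M, acl X = X `|` acl set0.

Definition indiscernible_over (L : vocabulary) (M : structure L)
    (X A : set M) : Prop :=
  forall n (x y : n.-tuple M),
    injective (tnth x) -> (forall i, X (tnth x i)) ->
    injective (tnth y) -> (forall i, X (tnth y i)) ->
  forall m (a : m.-tuple M), (forall i, A (tnth a i)) ->
  forall phi : formula L (n + m),
    sat phi [tuple of x ++ a] <-> sat phi [tuple of y ++ a].

Definition eqclass (L : vocabulary) (M : structure L) (xi : formula L 2)
    (a : M) : set M :=
  [set b | sat xi [tuple a; b]].

Definition restricted_equivalence (L : vocabulary) (T : theory L)
    (xi : formula L 2) (k t : nat) : Prop :=
  forall M : structure L, is_model T M ->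
  let classes := range (@eqclass L M xi) in
  [/\ RelationClasses.Equivalence (fun a b : M => sat xi [tuple a; b]),
      forall C, classes C -> infinite_set C \/ exists a, C = [set a],
      [set C | classes C /\ infinite_set C] #= `I_k &
      [set C | classes C /\ exists a, C = [set a]] #= `I_t].

Definition in_base_set (L : vocabulary) (M : structure L) (xi : formula L 2)
    (a : M) : Prop :=
  eqclass xi a = [set a].

(* The index set [i_k] is 'I_(i k); only k > 0 is relevant.  [J k n] is the set
   of numbers associated to (k, n). *)
Definition extension_properties (L : vocabulary) (T : theory L)
    (i : nat -> nat) (theta : forall k, 'I_(i k) -> formula L k)
    (J : forall k, 'I_(i k) -> {set 'I_(i k.+1)}) : Prop :=
  [/\ forall k, 0 < k -> forall M, is_model T M -> forall x : k.-tuple M,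
        injective (tnth x) -> exists n, sat (theta k n) x,
      (forall k, 0 < k -> forall n : 'I_(i k),
        [/\ exists j, j \in J k n,
            forall M, is_model T M -> forall x : k.-tuple M,
              sat (theta k n) x -> forall j, j \in J k n ->
              exists z, sat (theta k.+1 j) [tuple of rcons x z] &
            forall M, is_model T M -> forall x : k.-tuple M,
              sat (theta k n) x -> forall y, (forall r, y <> tnth x r) ->
              exists2 j, j \in J k n & sat (theta k.+1 j) [tuple of rcons x y]])
      /\ (forall j : 'I_(i 1), forall M, is_model T M ->
            exists z : M, sat (theta 1 j) [tuple z]),
      forall k, 0 < k -> forall n M, is_model T M -> forall x : k.-tuple M,
        sat (theta k n) x -> injective (tnth x) &
      forall k, 0 < k -> forall n, exists2 R : diagram L k, is_diagram R &
        forall M, is_model T M -> forall x : k.-tuple M,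
          sat (theta k n) x -> atDiag x = R].

(* The variables x_{a,1}, ..., x_{a,t_a} (a in [l], t_a > 0) are listed in
   lexicographic order.  Here t_a is written (t a).+1, since x_{a,1} must
   exist; x_{a,1} is [xvar a ord0]. *)
Definition nvars l (t : 'I_l -> nat) : nat := \sum_(a < l) (t a).+1.

Definition xvar l (t : 'I_l -> nat) (a : 'I_l) (alpha : 'I_(t a).+1) :
    'I_(nvars t) :=
  @tagnat.Rank l (fun a => (t a).+1) a alpha.

Definition gamma0_condition (L : vocabulary) (xi : formula L 2) l
    (Delta : 'I_l -> 'I_l -> {set diagram L 2}) (t : 'I_l -> nat)
    (gamma0 : formula L (nvars t)) : Prop :=
  forall (M : structure L) (x : (nvars t).-tuple M), sat gamma0 x ->
  forall a b : 'I_l,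
    (forall D, D \in Delta a b <->
       exists alpha beta,
         D = atDiag [tuple tnth x (@xvar l t a alpha);
                           tnth x (@xvar l t b beta)]) /\
    (forall alpha beta,
       sat xi [tuple tnth x (@xvar l t a alpha); tnth x (@xvar l t b beta)]
       <-> a = b).

(* Class indices j_1, ..., j_k and binary diagrams eta_{r,s}. *)
Definition index_data (L : vocabulary) l k : finType :=
  ({ffun 'I_k -> 'I_l} * {ffun 'I_k -> {ffun 'I_k -> diagram L 2}})%type.

Definition admissible (L : vocabulary) l
    (Delta : 'I_l -> 'I_l -> {set diagram L 2}) k (d : index_data L l k) :
    Prop :=
  (forall r s, d.2 r s \in Delta (d.1 r) (d.1 s)) /\
  exists (M : structure L) (y : k.-tuple M), injective (tnth y) /\
    forall r s, atDiag [tuple tnth y r; tnth y s] = d.2 r s.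

Definition extends (L : vocabulary) l k (d : index_data L l k)
    (d' : index_data L l k.+1) : bool :=
  let w := widen_ord (leqnSn k) in
  [forall r, d'.1 (w r) == d.1 r] &&
  [forall r, forall s, d'.2 (w r) (w s) == d.2 r s].

(* theta' is a formula in the variables x_{1,1}, ..., x_{l,t_l}, y_1, ..., y_k,
   in this order. *)
Definition expresses (L : vocabulary) (xi : formula L 2) l (t : 'I_l -> nat)
    k (d : index_data L l k) (theta' : formula L (nvars t + k)) : Prop :=
  forall (M : structure L) (x : (nvars t).-tuple M) (y : k.-tuple M),
    sat theta' [tuple of x ++ y] <->
    (forall r s, atDiag [tuple tnth y r; tnth y s] = d.2 r s) /\
    (forall r, sat xi [tuple tnth y r; tnth x (@xvar l t (d.1 r) ord0)]).

Definition extension_axiom (L : vocabulary) N (gamma0 : formula L N) k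
    (theta' : formula L (N + k)) : formula L k :=
  exs (And (rename gamma0 (@lshift N k)) theta').

Definition xi_Delta_extension_properties (L : vocabulary) (T : theory L)
    (xi : formula L 2) l (Delta : 'I_l -> 'I_l -> {set diagram L 2}) : Prop :=
  [/\ forall a b, exists D, D \in Delta a b,
      forall a b D, D \in Delta a b -> is_diagram D,
      exists k t, k + t = l /\ restricted_equivalence T xi k t &
      exists (t : 'I_l -> nat) (gamma0 : formula L (nvars t))
             (i : nat -> nat)
             (d : forall k, 'I_(i k) -> index_data L l k)
             (theta' : forall k, 'I_(i k) -> formula L (nvars t + k)),
        [/\ gamma0_condition xi Delta gamma0,
            forall k, 0 < k -> forall j,
              admissible Delta (d k j) /\ expresses xi (d k j) (theta' k j),
            forall k, 0 < k -> forall e : index_data L l k,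
              admissible Delta e -> exists j, d k j = e &
            extension_properties T
              (fun k j => extension_axiom gamma0 (theta' k j))
              (fun k j => [set j' | extends (d k j) (d k.+1 j')]%SET)]].

Definition xi_extension_properties (L : vocabulary) (T : theory L)
    (xi : formula L 2) : Prop :=
  exists l (Delta : 'I_l -> 'I_l -> {set diagram L 2}),
    xi_Delta_extension_properties T xi Delta.

Definition same_pair_diagrams (L : vocabulary) (T : theory L)
    (xi : formula L 2) : Prop :=
  forall M : structure L, is_model T M -> forall a b a' b' : M,
    ~ in_base_set xi a -> ~ in_base_set xi b ->
    ~ in_base_set xi a' -> ~ in_base_set xi b' ->
    a <> b -> a' <> b' -> atDiag [tuple a; b] = atDiag [tuple a'; b'].

(* Main.v *)
Require Import Defs.
From mathcomp Require Import all_boot.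
From mathcomp Require Import order.
From mathcomp Require Import boolp classical_sets functions cardinality filter.

Set Implicit Arguments.
Unset Strict Implicit.
Unset Printing Implicit Defensive.

Local Open Scope classical_set_scope.
Local Open Scope card_scope.

(** The three conditions say the same thing about a model: it is an infinite
    set of interchangeable elements together with finitely many special points,
    and the special points form a definable set.  This is [homogeneous_model]:
    over the finite set [A], the diagram of a pair depends only on whether its
    entries are equal and on which of them are which points of [A].

    In a binary vocabulary pairs decide everything.  The formulas true of a
    tuple are then determined by its quantifier-free type in the language of
    equality with names for the points of [A], because a fresh element of an
    infinite set can always be matched by another fresh element
    ([sat_similar]).  The pattern of diagrams over [A] is finite information, so
    that one sentence describes it, and completeness carries it to all models
    ([named_points]).  Indiscernibility of the complement of [A], strong
    minimality, triviality of the algebraic closure and categoricity in the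
    countable cardinal are then all direct applications of [sat_similar].  So
    are the extension properties ([named_extension_properties]): the classes of
    the equivalence relation are the complement of [A] and the points of [A],
    and every instance of an extension axiom is transported to one fixed model
    with fixed labels, where it only asks for a fresh element or for a
    prescribed point of [A].

    Conversely, each condition yields such a set [A].
    - For indiscernible sets, [A] is the complement, and homogeneity is
      indiscernibility for atomic formulas ([homogeneous_of_indiscernible]).
    - For a strongly minimal theory, [A] is the algebraic closure of the empty
      set.  Were it infinite, it would be a countable elementary substructure,
      and adding one non-algebraic element would give a second countable model
      not isomorphic to it; if the model at hand has no such element, an
      ultrapower has ([acl0_finite]).  Outside [A], triviality makes any element
      that differs from the parameters generic, so that such elements can be
      exchanged one at a time ([minimal_homogeneous]).
    - For extension properties, [A] is the union of the base sets.  The one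
      thing to show is that an element of the infinite class has the same
      diagram with a given base element as any other ([base_diagram]): if two
      diagrams were possible, an extension axiom would prescribe either of them
      for the unique remaining base element. *)

(** * Tuples and finite sets *)

Lemma tnth_cons0 (A : Type) n (x : A) (v : n.-tuple A) :
  tnth [tuple of x :: v] ord0 = x.
Proof. by []. Qed.

Lemma tnth_consS (A : Type) n (x : A) (v : n.-tuple A) i :
  tnth [tuple of x :: v] (lift ord0 i) = tnth v i.
Proof. exact: tnthS. Qed.

Lemma tnth_rcons_widen (A : Type) n (v : n.-tuple A) (x : A) i :
  tnth [tuple of rcons v x] (widen_ord (leqnSn n) i) = tnth v i.
Proof.
by rewrite !(tnth_nth x) /= nth_rcons size_tuple ltn_ord.
Qed.

Lemma tnth_rcons_max (A : Type) n (v : n.-tuple A) (x : A) :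
  tnth [tuple of rcons v x] ord_max = x.
Proof. by rewrite (tnth_nth x) /= nth_rcons size_tuple ltnn eqxx. Qed.

Lemma ord_lastP n (i : 'I_n.+1) :
  i = ord_max \/ exists j, i = widen_ord (leqnSn n) j.
Proof.
have [/eqP e|ne] := boolP (i == ord_max); first by left.
right; have lt : i < n.
  rewrite ltn_neqAle -ltnS ltn_ord andbT.
  by apply: contraNneq ne => e; apply/eqP/val_inj.
by exists (Ordinal lt); apply: val_inj.
Qed.

Lemma pairE (A : Type) (v : 2.-tuple A) :
  v = [tuple tnth v ord0; tnth v ord_max].
Proof.
apply: eq_from_tnth; case=> [[|[|//]] lt] //=.
  by rewrite [X in tnth v X](_ : _ = ord0) //; apply: val_inj.
by rewrite [X in tnth v X](_ : _ = ord_max) //; apply: val_inj.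
Qed.

Lemma finite_range (I : finType) (A : Type) (f : I -> A) :
  finite_set (range f).
Proof. exact/finite_image/finite_finset. Qed.

Lemma fresh_in (A : Type) (X : set A) (I : finType) (f : I -> A) :
  infinite_set X -> exists2 x, X x & forall i, f i <> x.
Proof.
move=> iX; have := infinite_setD iX (finite_range f).
move=> /infinite_setN0 [x [Xx nx]]; exists x => // i e; apply: nx.
by exists i.
Qed.

Lemma fresh (A : Type) (I : finType) (f : I -> A) :
  infinite_set [set: A] -> exists x, forall i, f i <> x.
Proof. by case/(fresh_in f) => x _ h; exists x. Qed.

Lemma finite_enum (A : Type) (X : set A) : finite_set X ->
  exists m (b : 'I_m -> A), injective b /\ forall x, X x <-> exists c, x = b c.
Proof.
move=> fX; have /finite_seqP [s Xs] : finite_set (X : set {classic A}) by [].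
exists (size (undup s)), (tnth (in_tuple (undup s))); split.
  by apply/(@tuple_uniqP _ {classic A}); exact: undup_uniq.
move=> x; rewrite Xs /= -[x \in s]mem_undup.
by split=> [/(@tnthP _ _ (in_tuple (undup s)))|] [c ->]; [exists c|exact: mem_tnth].
Qed.

(** * First-order definability *)

Lemma sat_rename (L : vocabulary) m (phi : formula L m) n (f : 'I_m -> 'I_n)
    (M : structure L) (v : n.-tuple M) :
  sat (rename phi f) v <-> sat phi [tuple tnth v (f i) | i < m].
Proof.
elim: phi n f v => {m} [m a|m psi IH|m psi IH1 chi IH2|m psi IH] n f v /=.
- case: a => [[i j]|[r w]] /=.
    by rewrite !tnth_mktuple.
  rewrite (_ : [tuple of _] =
    [tuple of map (tnth [tuple tnth v (f i) | i < m]) w]) //.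
  by apply: eq_from_tnth => i; rewrite !tnth_map tnth_ord_tuple.
- by split=> h /IH.
- by split=> -[/IH1 ? /IH2].
have e (x : M) : [tuple tnth [tuple of x :: v] (lift_renaming f i) | i < m.+1] =
    [tuple of x :: [tuple tnth v (f i) | i < m]].
  apply: eq_from_tnth => i; rewrite tnth_mktuple /lift_renaming.
  case: (unliftP ord0 i) => [j ->|->]; last by rewrite !tnth_cons0.
  by rewrite !tnth_consS tnth_mktuple.
by split=> -[x sx]; exists x; [rewrite -e; apply/IH|apply/IH; rewrite e].
Qed.

(** A property of n-tuples, uniform in the structure, that some formula
    expresses.  Formulas are produced through the closure properties of this
    notion, so that no syntax has to be written down. *)
Definition definable (L : vocabulary) n
    (P : forall M : structure L, n.-tuple M -> Prop) : Prop :=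
  exists phi : formula L n, forall (M : structure L) (v : n.-tuple M), sat phi v <-> P M v.

Lemma definable_iff (L : vocabulary) n
    (P Q : forall M : structure L, n.-tuple M -> Prop) :
  definable P -> (forall M v, P M v <-> Q M v) -> definable Q.
Proof.
by case=> phi hphi PQ; exists phi => M v; rewrite hphi PQ.
Qed.

Lemma definable_sat (L : vocabulary) n (phi : formula L n) :
  definable (fun M v => sat (M := M) phi v).
Proof. by exists phi. Qed.

Lemma definable_subst (L : vocabulary) m n (f : 'I_m -> 'I_n)
    (P : forall M : structure L, m.-tuple M -> Prop) :
  definable P -> definable (fun M v => P M [tuple tnth v (f i) | i < m]).
Proof.
by case=> phi h; exists (rename phi f) => M v; rewrite sat_rename h.
Qed.

Lemma definable_not (L : vocabulary) n
    (P : forall M : structure L, n.-tuple M -> Prop) :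
  definable P -> definable (fun M v => ~ P M v).
Proof. by case=> phi h; exists (Not phi) => M v /=; rewrite h. Qed.

Lemma definable_and (L : vocabulary) n
    (P Q : forall M : structure L, n.-tuple M -> Prop) :
  definable P -> definable Q -> definable (fun M v => P M v /\ Q M v).
Proof.
by case=> phi h [psi k]; exists (And phi psi) => M v /=; rewrite h k.
Qed.

Lemma definable_or (L : vocabulary) n
    (P Q : forall M : structure L, n.-tuple M -> Prop) :
  definable P -> definable Q -> definable (fun M v => P M v \/ Q M v).
Proof.
move=> dP dQ.
apply: (definable_iff (definable_not
  (definable_and (definable_not dP) (definable_not dQ)))) => M v.
by rewrite not_andE !not_notE.
Qed.

Lemma definable_ex (L : vocabulary) n
    (P : forall M : structure L, n.+1.-tuple M -> Prop) :
  definable P -> definable (fun M v => exists x, P M [tuple of x :: v]).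
Proof.
by case=> phi h; exists (Ex phi) => M v /=; split=> -[x /h]; exists x => //;
  apply/h.
Qed.

Lemma definable_all (L : vocabulary) n
    (P : forall M : structure L, n.+1.-tuple M -> Prop) :
  definable P -> definable (fun M v => forall x, P M [tuple of x :: v]).
Proof.
move=> dP; apply: (definable_iff (definable_not (definable_ex
  (definable_not dP)))) => M v.
by split=> [h x|h [x]]; [apply: contrapT => nP; apply: h; exists x|apply].
Qed.

Lemma definable_true (L : vocabulary) n :
  definable (fun (M : structure L) (v : n.-tuple M) => True).
Proof.
exists (Not (Ex (Not (Atom (inl (ord0, ord0)))))) => M v /=.
by split=> // _ [x].
Qed.

Lemma definable_forall (L : vocabulary) n (I : finType)
    (P : I -> forall M : structure L, n.-tuple M -> Prop) :
  (forall i, definable (P i)) -> definable (fun M v => forall i, P i M v).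
Proof.
move=> dP; suff : definable (fun M v => forall i, i \in enum I -> P i M v).
  move=> d; apply: (definable_iff d) => M v.
  by split=> h i => [|_]; apply: h; rewrite mem_enum.
elim: (enum I) => [|j s IH].
  by apply: (definable_iff (definable_true L n)) => M v; split.
apply: (definable_iff (definable_and (dP j) IH)) => M v; split.
  by case=> Pj Ps i; rewrite inE => /predU1P [-> //|/Ps].
by move=> h; split=> [|i si]; apply: h; rewrite inE ?eqxx ?si ?orbT.
Qed.

Lemma atDiagE (L : vocabulary) (M : structure L) n (v : n.-tuple M) a :
  a \in atDiag v <-> sat_atomic v a.
Proof. by rewrite inE; split=> /asboolP. Qed.

Lemma atDiag_eqP (L : vocabulary) (M N : structure L) n (v : n.-tuple M)
    (w : n.-tuple N) :
  atDiag v = atDiag w <-> forall a, sat_atomic v a <-> sat_atomic w a.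
Proof.
split=> [e a|h]; first by rewrite -!atDiagE e.
by apply/setP => a; apply/idP/idP => /atDiagE /h /atDiagE.
Qed.

Lemma definable_diag (L : vocabulary) n (S : {set diagram L n}) :
  definable (fun (M : structure L) (v : n.-tuple M) => atDiag v \in S).
Proof.
have d1 (R : diagram L n) : definable (fun (M : structure L) (v : n.-tuple M) => atDiag v <> R).
  apply: definable_not.
  have d (a : atomic L n) : definable
      (fun (M : structure L) (v : n.-tuple M) => sat_atomic v a <-> a \in R).
    case aR : (a \in R).
      apply: (definable_iff (definable_sat (Atom a))) => M v /=.
      by split=> [h|->].
    apply: (definable_iff (definable_sat (Not (Atom a)))) => M v /=.
    by split=> [h|h /h].
  apply: (definable_iff (definable_forall d)) => M v; split=> [h|<- a].
    by apply/setP => a; apply/idP/idP => [/atDiagE/h|/h/atDiagE].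
  by rewrite atDiagE.
have d2 (R : diagram L n) :
    definable (fun (M : structure L) (v : n.-tuple M) => R \notin S -> atDiag v <> R).
  case: (R \in S); last by apply: (definable_iff (d1 R)) => M v; split=> // h; exact: h.
  by apply: (definable_iff (definable_true L n)).
apply: (definable_iff (definable_forall d2)) => M v; split=> [h|h R nR e].
  by apply/negPn/negP => /h.
by move: nR; rewrite -e h.
Qed.

Lemma definable_diag_eq (L : vocabulary) n (R : diagram L n) :
  definable (fun (M : structure L) (v : n.-tuple M) => atDiag v = R).
Proof.
apply: (definable_iff (definable_diag [set R]%SET)) => M v.
by rewrite inE; split=> /eqP.
Qed.

Lemma sat_rename_atomic (L : vocabulary) (M : structure L) m n
    (f : 'I_m -> 'I_n) (v : n.-tuple M) a :
  sat_atomic v (rename_atomic f a) <->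
  sat_atomic [tuple tnth v (f i) | i < m] a.
Proof. exact: (sat_rename (Atom a)). Qed.

Lemma atDiag_subst (L : vocabulary) (M N : structure L) m n
    (f : 'I_m -> 'I_n) (v : n.-tuple M) (w : n.-tuple N) :
  atDiag v = atDiag w ->
  atDiag [tuple tnth v (f i) | i < m] = atDiag [tuple tnth w (f i) | i < m].
Proof.
by move=> /atDiag_eqP h; apply/atDiag_eqP => a; rewrite -!sat_rename_atomic h.
Qed.

Lemma sat_exs (L : vocabulary) N k (phi : formula L (N + k)) (M : structure L)
    (v : k.-tuple M) :
  sat (exs phi) v <-> exists x : N.-tuple M, sat phi [tuple of x ++ v].
Proof.
elim: N phi => [|N IH] phi /=.
  split=> [h|[x]].
    exists [tuple]; rewrite (_ : [tuple of _] = v) //; exact: val_inj.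
  rewrite tuple0 (_ : [tuple of _] = v) //; exact: val_inj.
rewrite IH; split=> -[x] /=.
  case=> y h; exists [tuple of y :: x].
  rewrite (_ : [tuple of _ ++ _] =
    ([tuple of y :: [tuple of x ++ v]] : (N.+1 + k).-tuple M)) //.
  exact: val_inj.
case/tupleP: x => y x h; exists x, y.
rewrite (_ : [tuple of _ :: _] =
  ([tuple of [tuple of y :: x] ++ v] : (N.+1 + k).-tuple M)) //.
exact: val_inj.
Qed.

Lemma definable_exs (L : vocabulary) N k
    (P : forall M : structure L, (N + k).-tuple M -> Prop) :
  definable P ->
  definable (fun M v => exists x : N.-tuple M, P M [tuple of x ++ v]).
Proof.
case=> phi h; exists (exs phi) => M v; rewrite sat_exs.
by split=> -[x /h]; exists x => //; apply/h.
Qed.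

(** * Back and forth over named points *)

(** Equality of the quantifier-free types of two families, in the language of
    equality with constants for the named points [b] and [b']. *)
Definition similar (A B C I : Type) (b : C -> A) (b' : C -> B) (f : I -> A)
    (g : I -> B) : Prop :=
  (forall i j, f i = f j <-> g i = g j) /\
  (forall i c, f i = b c <-> g i = b' c).

Lemma similar_sym (A B C I : Type) (b : C -> A) (b' : C -> B) (f : I -> A)
    (g : I -> B) : similar b b' f g -> similar b' b g f.
Proof. by case=> h k; split=> i j; [rewrite h|rewrite k]. Qed.

Lemma similar_trans (A B D C I : Type) (b : C -> A) (b' : C -> B) (b'' : C -> D)
    (f : I -> A) (g : I -> B) (h : I -> D) :
  similar b b' f g -> similar b' b'' g h -> similar b b'' f h.
Proof.
case=> h1 h2 [k1 k2]; split=> i j; first by rewrite h1 k1.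
by rewrite h2 k2.
Qed.

Lemma similar_reindex (A B C I J : Type) (b : C -> A) (b' : C -> B) (f : I -> A)
    (g : I -> B) (h : J -> I) (f' : J -> A) (g' : J -> B) :
  similar b b' f g -> (forall j, f' j = f (h j)) -> (forall j, g' j = g (h j)) ->
  similar b b' f' g'.
Proof.
by case=> h1 h2 ef eg; split=> i j; rewrite ?ef ?eg; [exact: h1|exact: h2].
Qed.

Lemma similar_pair (A B C : Type) (b : C -> A) (b' : C -> B) p q p' q' :
  similar b b' (tnth [tuple p; q]) (tnth [tuple p'; q']) <->
  [/\ p = q <-> p' = q', forall c, p = b c <-> p' = b' c &
      forall c, q = b c <-> q' = b' c].
Proof.
split=> [[h k]|[h k1 k2]].
  by split=> [|c|c]; [exact: (h ord0 ord_max)|exact: (k ord0)|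
    exact: (k ord_max)].
split=> -[[|[|//]] i].
- by case=> [[|[|//]] j]; rewrite !(tnth_nth p) !(tnth_nth p').
- case=> [[|[|//]] j]; rewrite !(tnth_nth p) !(tnth_nth p') //=.
  by split=> /esym /h.
- by move=> c; rewrite !(tnth_nth p) !(tnth_nth p').
- by move=> c; rewrite !(tnth_nth p) !(tnth_nth p').
Qed.

Lemma similar_cons (A B : Type) (C : finType) (b : C -> A) (b' : C -> B) n
    (v : n.-tuple A) (w : n.-tuple B) (x : A) :
  (forall c d, b c = b d <-> b' c = b' d) -> infinite_set [set: B] ->
  similar b b' (tnth v) (tnth w) ->
  exists y, similar b b' (tnth [tuple of x :: v]) (tnth [tuple of y :: w]).
Proof.
move=> bb' iB [h k].
have [y [y1 y2]] : exists y, (forall i, x = tnth v i <-> y = tnth w i) /\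
    (forall c, x = b c <-> y = b' c).
  have [[i ->]|nv] := pselect (exists i, x = tnth v i).
    by exists (tnth w i); split.
  have [[c ->]|nb] := pselect (exists c, x = b c).
    exists (b' c); split=> [i|//]; split=> /esym e; apply/esym; exact/k.
  have [y hy] := fresh (fun z : 'I_n + C =>
    match z with inl i => tnth w i | inr c => b' c end) iB.
  exists y; split=> [i|c]; split=> e.
  - by case: nv; exists i.
  - by case: (hy (inl i)).
  - by case: nb; exists c.
  - by case: (hy (inr c)).
exists y; split=> i.
  move=> j; case: (unliftP ord0 i) => [i' ->|->];
    case: (unliftP ord0 j) => [j' ->|->]; rewrite ?tnth_cons0 ?tnth_consS //.
  by split=> /esym /y1 /esym.
by move=> c; case: (unliftP ord0 i) => [i' ->|->];
  rewrite ?tnth_cons0 ?tnth_consS.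
Qed.

Lemma similar_realize (A B : Type) (C : finType) (b : C -> A) (b' : C -> B) n
    (v : n.-tuple A) :
  (forall c d, b c = b d <-> b' c = b' d) -> infinite_set [set: B] ->
  exists w : n.-tuple B, similar b b' (tnth v) (tnth w).
Proof.
move=> bb' iB; elim: n v => [|n IH] v; first by exists [tuple]; split; case.
case/tupleP: v => x v; have [w sim] := IH v.
by have [y sim'] := similar_cons x bb' iB sim; exists [tuple of y :: w].
Qed.

(** The relations of both structures are read off, in the same way, from the
    quantifier-free equality type over the named points. *)
Definition compatible (L : vocabulary) (M N : structure L) (C : Type)
    (b : C -> M) (b' : C -> N) : Prop :=
  (forall c d, b c = b d <-> b' c = b' d) /\
  forall r (v : (arity r).-tuple M) (w : (arity r).-tuple N),
    similar b b' (tnth v) (tnth w) -> (interp M r v <-> interp N r w).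

Lemma compatible_sym (L : vocabulary) (M N : structure L) (C : Type)
    (b : C -> M) (b' : C -> N) : compatible b b' -> compatible b' b.
Proof.
case=> h k; split=> [c d|r v w /similar_sym /k]; first by rewrite h.
by move=> ->.
Qed.

Lemma compatible_trans (L : vocabulary) (M N K : structure L) (C : finType)
    (b : C -> M) (b' : C -> N) (b'' : C -> K) : infinite_set [set: N] ->
  compatible b b' -> compatible b' b'' -> compatible b b''.
Proof.
move=> iN [h1 h2] [k1 k2]; split=> [c d|r v w vw]; first by rewrite h1.
have [u vu] := similar_realize v h1 iN.
by rewrite (h2 _ _ _ vu) (k2 _ _ _ (similar_trans (similar_sym vu) vw)).
Qed.

(** The back-and-forth argument: a similarity can always be continued to one
    more element, because infinite structures do not run out of elements that
    differ from the finitely many given ones. *)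
Lemma sat_similar (L : vocabulary) (M N : structure L) (C : finType)
    (b : C -> M) (b' : C -> N) n (phi : formula L n) (v : n.-tuple M)
    (w : n.-tuple N) :
  infinite_set [set: M] -> infinite_set [set: N] -> compatible b b' ->
  similar b b' (tnth v) (tnth w) -> (sat phi v <-> sat phi w).
Proof.
move=> iM iN cbb'; elim: phi v w
  => {n} [n a|n psi IH|n psi IH1 chi IH2|n psi IH] v w sim /=.
- case: a => [[i j]|[r u]] /=; first exact: sim.1.
  by apply: cbb'.2; apply: (similar_reindex sim) => i; rewrite tnth_map.
- by rewrite (IH _ _ sim).
- by rewrite (IH1 _ _ sim) (IH2 _ _ sim).
split=> -[x].
  have [y sim'] := similar_cons x cbb'.1 iN sim.
  by move=> /(IH _ _ sim') ?; exists y.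
have [y sim'] := similar_cons x (compatible_sym cbb').1 iM (similar_sym sim).
by move=> /(IH _ _ (similar_sym sim')) ?; exists y.
Qed.

Lemma atDiag_similar (L : vocabulary) (M N : structure L) (C : finType)
    (b : C -> M) (b' : C -> N) n (v : n.-tuple M) (w : n.-tuple N) :
  infinite_set [set: M] -> infinite_set [set: N] -> compatible b b' ->
  similar b b' (tnth v) (tnth w) -> atDiag v = atDiag w.
Proof.
move=> iM iN cbb' sim; apply/atDiag_eqP => a.
exact: (sat_similar (Atom a) iM iN cbb' sim).
Qed.

(** A relation of arity at most two is an atomic formula about a pair.  For a
    nullary relation some pair has to be chosen, and then matched by a similar
    one, which an infinite structure provides. *)
Lemma compatible_of_pairs (L : vocabulary) (M N : structure L) (C : finType)
    (b : C -> M) (b' : C -> N) :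
  binary L -> infinite_set [set: N] ->
  (forall c d, b c = b d <-> b' c = b' d) ->
  (forall p q p' q', similar b b' (tnth [tuple p; q]) (tnth [tuple p'; q']) ->
     atDiag [tuple p; q] = atDiag [tuple p'; q']) ->
  compatible b b'.
Proof.
move=> hL iN bb' hpq; split=> // r v w sim.
suff [p [q [p' [q' [h [ev ew simp]]]]]] : exists p q p' q'
    (h : 'I_(arity r) -> 'I_2),
    [/\ forall i, tnth v i = tnth [tuple p; q] (h i),
        forall i, tnth w i = tnth [tuple p'; q'] (h i) &
        similar b b' (tnth [tuple p; q]) (tnth [tuple p'; q'])].
  have /atDiag_eqP /(_ (inr (existT _ r [tuple h i | i < arity r]))) :=
    hpq _ _ _ _ simp.
  rewrite /sat_atomic (_ : [tuple of map _ _] = v); last first.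
    by apply: eq_from_tnth => i; rewrite tnth_map tnth_mktuple ev.
  rewrite (_ : [tuple of map _ _] = w) //.
  by apply: eq_from_tnth => i; rewrite tnth_map tnth_mktuple ew.
move: (arity r) (hL r) v w sim => [|[|[|//]]] _ v w sim.
- have [p] := structure_inhabited M.
  have [u s] := similar_realize [tuple p; p] bb' iN.
  exists p, p, (tnth u ord0), (tnth u ord_max), (fun=> ord0).
  by split=> [[]//|[]//|]; rewrite -pairE.
- exists (tnth v ord0), (tnth v ord0), (tnth w ord0), (tnth w ord0), (fun=> ord0).
  split=> [i|i|]; rewrite ?(ord1 i) //; apply/similar_pair.
  by split=> // c; exact: sim.2.
- exists (tnth v ord0), (tnth v ord_max), (tnth w ord0), (tnth w ord_max), id.
  by rewrite -!pairE.
Qed.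

(** * Transfer between the models of a complete theory *)

Lemma definable_exists_tuple (L : vocabulary) k
    (P : forall M : structure L, k.-tuple M -> Prop) : definable P ->
  exists sigma : formula L 0, forall M : structure L,
    sat sigma ([tuple] : 0.-tuple M) <-> exists x, P M x.
Proof.
move=> /(definable_subst (@lshift k 0)) /definable_exs [sigma h].
exists sigma => M; rewrite h.
have e (x : k.-tuple M) : [tuple tnth [tuple of x ++ [tuple]] (lshift 0 i) | i < k] = x.
  by apply: eq_from_tnth => i; rewrite tnth_mktuple tnth_lshift.
by split=> -[x Px]; exists x; [move: Px; rewrite e | rewrite e].
Qed.

Lemma complete_transfer (L : vocabulary) (T : theory L) (M N : structure L)
    (sigma : formula L 0) : complete T -> is_model T M -> is_model T N ->
  sat sigma ([tuple] : 0.-tuple M) -> sat sigma ([tuple] : 0.-tuple N).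
Proof. by move=> [_ /(_ sigma) [h|h]] TM TN; [move=> _; exact: h|have := h _ TM]. Qed.

Lemma injective_tuple (A : Type) n : infinite_set [set: A] ->
  exists w : n.-tuple A, injective (tnth w).
Proof.
move=> iA; pose b := fun c : void => match c return nat with end.
pose b' := fun c : void => match c return A with end.
have bb' c d : b c = b d <-> b' c = b' d by case: c.
have [w sim] := similar_realize (mktuple (@nat_of_ord n)) bb' iA.
exists w => i j /sim.1; rewrite !tnth_mktuple; exact: val_inj.
Qed.

Lemma infinite_models (L : vocabulary) (T : theory L) : complete T ->
  has_infinite_models T -> forall M, is_model T M -> infinite_set [set: M].
Proof.
move=> cT [M [TM iM]] N TN /finite_enum [m [b [_ bP]]].
have d (ij : 'I_m.+1 * 'I_m.+1) :
    definable (fun (K : structure L) (x : m.+1.-tuple K) =>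
      ij.1 = ij.2 \/ ~ tnth x ij.1 = tnth x ij.2).
  case: (pselect (ij.1 = ij.2)) => e.
    by apply: (definable_iff (definable_true L m.+1)) => K v; split=> // _; left.
  apply: (definable_iff (definable_sat (Not (Atom (inl ij))))) => K v.
  by case: ij e => i j /= e; split=> [|[]]; [right|..].
have [sigma sE] := definable_exists_tuple (definable_forall d).
have /(complete_transfer cT TM TN) /sE [w inj] :
    sat sigma ([tuple] : 0.-tuple M).
  apply/sE; have [w inj] := injective_tuple m.+1 iM; exists w => -[i j] /=.
  by case: (pselect (i = j)) => e; [left|right=> /inj].
have {}inj i j : tnth w i = tnth w j -> i = j by case: (inj (i, j)) => /=.
have /choice [h hE] : forall i, exists c, tnth w i = b c by move=> i; apply/bP.
have /leq_card : injective h.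
  by move=> i j e; apply: inj; rewrite !hE e.
by rewrite !card_ord ltnn.
Qed.

Lemma atDiag_eq_tnth (L : vocabulary) (M N : structure L) n (v : n.-tuple M)
    (w : n.-tuple N) i j :
  atDiag v = atDiag w -> tnth v i = tnth v j <-> tnth w i = tnth w j.
Proof. by move=> /atDiag_eqP /(_ (inl (i, j))). Qed.

(** The formula says that a structure looks like [M] over [u]: each pair of
    elements has, together with the tuple, a diagram that occurs in [M].  There
    are finitely many diagrams, so this is first order. *)
Lemma definable_compatible (L : vocabulary) (M : structure L) m
    (u : m.-tuple M) : binary L -> infinite_set [set: M] ->
  compatible (tnth u) (tnth u) ->
  exists psi : formula L m, sat psi u /\
    forall (N : structure L) (w : m.-tuple N), infinite_set [set: N] ->
      sat psi w -> compatible (tnth u) (tnth w).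
Proof.
move=> hL iM cu.
pose S := [set R : diagram L m.+2 |
  `[< exists p q : M, atDiag [tuple of p :: [tuple of q :: u]] = R >]]%SET.
have [psi hpsi] := definable_all (definable_all (definable_diag S)).
exists psi; split.
  by apply/hpsi => q p; rewrite inE; apply/asboolP; exists p, q.
move=> N w iN /hpsi sw.
have hw p q : exists p0 q0, atDiag [tuple of p0 :: [tuple of q0 :: u]] =
    atDiag [tuple of p :: [tuple of q :: w]].
  by have := sw q p; rewrite inE => /asboolP.
apply: compatible_of_pairs => // [c d|p q p' q' sim].
  have [x] := structure_inhabited N; have [p [q e]] := hw x x.
  have := atDiag_eq_tnth (lift ord0 (lift ord0 c)) (lift ord0 (lift ord0 d)) e.
  by rewrite !tnth_consS.
have [p0 [q0 e]] := hw p' q'.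
have sim0 : similar (tnth u) (tnth w) (tnth [tuple p0; q0]) (tnth [tuple p'; q']).
  apply/similar_pair; split.
  - have := atDiag_eq_tnth ord0 (lift ord0 ord0) e.
    by rewrite tnth_consS !tnth_cons0 tnth_consS tnth_cons0.
  - move=> c; have := atDiag_eq_tnth ord0 (lift ord0 (lift ord0 c)) e.
    by rewrite !tnth_consS !tnth_cons0.
  - move=> c; have := atDiag_eq_tnth (lift ord0 ord0) (lift ord0 (lift ord0 c)) e.
    by rewrite !tnth_consS !tnth_cons0.
rewrite (atDiag_similar iM iM cu (similar_trans sim (similar_sym sim0))).
pose h (i : 'I_2) : 'I_m.+2 := if i == ord0 then ord0 else lift ord0 ord0.
have hE (A : Type) (x y : A) (v : m.-tuple A) :
    [tuple tnth [tuple of x :: [tuple of y :: v]] (h i) | i < 2] = [tuple x; y].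
  by apply: eq_from_tnth; case=> [[|[|//]] i]; rewrite tnth_mktuple.
by have := atDiag_subst h e; rewrite !hE.
Qed.

Lemma compatible_transfer (L : vocabulary) (T : theory L) (M N : structure L) m
    (b : 'I_m -> M) : binary L -> complete T -> has_infinite_models T ->
  is_model T M -> is_model T N -> compatible b b ->
  exists b' : 'I_m -> N, compatible b b'.
Proof.
move=> hL cT iT TM TN cb.
have eb : tnth (mktuple b) = b by apply: funext => i; rewrite tnth_mktuple.
have [] := @definable_compatible L M m (mktuple b) hL (infinite_models cT iT TM).
  by rewrite eb.
move=> psi [sb hpsi].
have [sigma hsigma] := definable_exists_tuple (definable_sat psi).
have /(complete_transfer cT TM TN) /hsigma [w sw] :
    sat sigma ([tuple] : 0.-tuple M) by apply/hsigma; exists (mktuple b).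
exists (tnth w); rewrite -{1}eb; apply: hpsi sw; exact: infinite_models cT iT N TN.
Qed.

(** * Homogeneous sets of named points *)

(** The common content of the three conditions: up to the points of [A], the
    diagram of a pair only depends on whether its two entries are equal. *)
Definition homogeneous (L : vocabulary) (M : structure L) (A : set M) : Prop :=
  forall p q p' q' : M, (p = q <-> p' = q') ->
    (A p \/ A p' -> p = p') -> (A q \/ A q' -> q = q') ->
    atDiag [tuple p; q] = atDiag [tuple p'; q'].

Lemma homogeneous_compatible (L : vocabulary) (M : structure L) (A : set M)
    (C : finType) (b : C -> M) : binary L -> infinite_set [set: M] ->
  homogeneous A -> (forall x, A x <-> exists c, x = b c) -> compatible b b.
Proof.
move=> hL iM hA bP; apply: compatible_of_pairs => // p q p' q'.
case/similar_pair => e hp hq; apply: hA => //.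
  by case=> /bP [c ec]; [rewrite ec; apply/esym/hp|rewrite ec; apply/hp].
by case=> /bP [c ec]; [rewrite ec; apply/esym/hq|rewrite ec; apply/hq].
Qed.

Lemma definable_generic_transfer (L : vocabulary) (M N : structure L) m
    (b : 'I_m -> M) (b' : 'I_m -> N) (phi : formula L 1) :
  infinite_set [set: M] -> infinite_set [set: N] -> compatible b b' ->
  (forall x, sat phi [tuple x] <-> ~ exists c, x = b c) ->
  forall y, sat phi [tuple y] <-> ~ exists c, y = b' c.
Proof.
move=> iM iN cbb' hphi y.
have [v sim] := similar_realize [tuple y] (compatible_sym cbb').1 iM.
rewrite (sat_similar phi iN iM (compatible_sym cbb') sim).
have ev : v = [tuple tnth v ord0].
  by apply: eq_from_tnth => i; rewrite (ord1 i).
rewrite ev hphi; split=> h [c /(sim.2 ord0 c) e]; by apply: h; exists c.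
Qed.

(** * Countable models *)

Lemma countable_enum (A : Type) (X : set A) : X #= [set: nat] ->
  exists g : nat -> A, injective g /\ forall x, X x <-> exists n, x = g n.
Proof.
move=> /card_set_bijP [f [_ finj fsurj]].
have /choice [g hg] : forall n, exists x, X x /\ f x = n.
  by move=> n; have [x Xx e] := fsurj n I; exists x.
exists g; split=> [i j e|x]; first by rewrite -(hg i).2 e (hg j).2.
split=> [Xx|[n ->]]; last exact: (hg n).1.
exists (f x); apply: finj; rewrite ?inE //; first exact: (hg _).1.
by rewrite (hg _).2.
Qed.

Lemma infinite_enum (A : Type) (X : set A) : infinite_set X ->
  exists g : nat -> A, injective g /\ forall n, X (g n).
Proof.
elim/Ppointed: A => A in X *.
  by move=> iX; exfalso; apply: iX; rewrite emptyE; exact: finite_set0.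
move=> /infiniteP /pcard_leP /injfunPex [g gX ginj].
by exists g; split=> [i j|n]; [apply: ginj; rewrite inE|exact: gX].
Qed.

(** Enumerations of two structures that start with their named points match
    these points with each other. *)
Definition prepend (A : Type) m (b : 'I_m -> A) (g : nat -> A) (n : nat) : A :=
  match insub n with Some c => b c | None => g (n - m) end.

Lemma prepend_ord (A : Type) m (b : 'I_m -> A) (g : nat -> A) (c : 'I_m) :
  prepend b g c = b c.
Proof. by rewrite /prepend valK. Qed.

Lemma prepend_addn (A : Type) m (b : 'I_m -> A) (g : nat -> A) n :
  prepend b g (m + n) = g n.
Proof.
by rewrite /prepend insubF ?addKn // ltnNge leq_addr.
Qed.

Lemma ord_or_addn (m n : nat) : (exists c : 'I_m, n = c) \/ exists k, n = m + k.
Proof.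
have [lt|le] := ltnP n m; first by left; exists (Ordinal lt).
by right; exists (n - m); rewrite subnKC.
Qed.

Lemma prepend_inj (A : Type) m (b : 'I_m -> A) (g : nat -> A) :
  injective b -> injective g -> (forall n c, g n <> b c) ->
  injective (prepend b g).
Proof.
move=> bi gi gb i j.
case: (ord_or_addn m i) => -[i' ->]; case: (ord_or_addn m j) => -[j' ->];
  rewrite ?prepend_ord ?prepend_addn.
- by move=> /bi ->.
- by move=> /esym /gb.
- by move=> /gb.
- by move=> /gi ->.
Qed.

(** The structure induced on [A] by a function into [M]; for an injective
    function this is a substructure. *)
Definition pullback (L : vocabulary) (M : structure L) (A : Type) (f : A -> M)
    (iA : inhabited A) : structure L :=
  @Structure L A (fun r v => interp M r [tuple of map f v]) iA.

Lemma pullback_compatible (L : vocabulary) (M : structure L) (A C : Type)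
    (f : A -> M) (iA : inhabited A) (b : C -> M) (b' : C -> A) :
  injective f -> (forall c, b c = f (b' c)) -> compatible b b ->
  @compatible L M (pullback f iA) C b b'.
Proof.
move=> fi e cb; split=> [c d|r v w [h k]].
  by rewrite !e; split=> [/fi|->].
apply: cb.2; split=> i j; rewrite ?tnth_map; last by rewrite k e; split=> [->|/fi].
by rewrite h; split=> [->|/fi].
Qed.

(** * Consequences of homogeneity *)

(** The special points are given through a formula for their complement, which
    makes them definable without parameters. *)
Definition homogeneous_model (L : vocabulary) (M : structure L)
    (phi : formula L 1) : Prop :=
  let A := ~` defset phi ([tuple] : 0.-tuple M) in
  finite_set A /\ homogeneous A.

Lemma cons_nil (A : Type) (x : A) :
  [tuple of x :: ([tuple] : 0.-tuple A)] = [tuple x].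
Proof. exact: val_inj. Qed.

(** The named points of another model come from [compatible_transfer].  Similar
    tuples of the two models then satisfy the same formulas, and [phi] is one of
    these. *)
Lemma named_points (L : vocabulary) (T : theory L) (M : structure L)
    (phi : formula L 1) : binary L -> complete T -> has_infinite_models T ->
  is_model T M -> homogeneous_model M phi ->
  exists m (b : 'I_m -> M),
    [/\ injective b, compatible b b,
        forall x, sat phi [tuple x] <-> ~ exists c, x = b c &
        forall N, is_model T N -> exists b' : 'I_m -> N,
          [/\ compatible b b', injective b' &
              forall x, sat phi [tuple x] <-> ~ exists c, x = b' c]].
Proof.
move=> hL cT iT TM [/finite_enum [m [b [bi bP]]] hA]; exists m, b.
have iM := infinite_models cT iT TM.
have cb := homogeneous_compatible hL iM hA bP.
have bphi x : sat phi [tuple x] <-> ~ exists c, x = b c.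
  rewrite -bP /= /defset /= cons_nil; split=> [h nh|nn]; first exact: nh.
  exact: contrapT.
split=> // N TN; have [b' cb'] := compatible_transfer hL cT iT TM TN cb.
have iN := infinite_models cT iT TN.
exists b'; split=> //; first by move=> c d /cb'.1 /bi.
exact: (definable_generic_transfer iM iN cb' bphi).
Qed.

Section NamedPoints.

Variables (L : vocabulary) (M : structure L) (m : nat) (b : 'I_m -> M).
Variable phi : formula L 1.
Hypotheses (iM : infinite_set [set: M]) (cb : compatible b b).
Hypothesis bphi : forall x, sat phi [tuple x] <-> ~ exists c, x = b c.

Lemma not_defset : ~` defset phi ([tuple] : 0.-tuple M) = range b.
Proof.
apply/seteqP; split=> x; rewrite /= /defset /= cons_nil bphi.
  by move=> /contrapT [c ->]; exists c.
by case=> c _ <-; apply; exists c.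
Qed.

Lemma finite_named : finite_set (range b).
Proof. exact: finite_range. Qed.

(** Injective tuples of generic elements have the same equality type over all
    the named points, which include the parameters. *)
Lemma homogeneous_indiscernible :
  indiscernible_over (defset phi ([tuple] : 0.-tuple M))
    (~` defset phi ([tuple] : 0.-tuple M)).
Proof.
have nX c x : defset phi ([tuple] : 0.-tuple M) x -> x <> b c.
  by rewrite /defset /= cons_nil => /bphi h e; apply: h; exists c.
move=> n x y xi xX yi yX k a aA psi.
apply: (sat_similar psi iM iM cb).
have aE i : exists c, tnth a i = b c.
  have : (~` defset phi ([tuple] : 0.-tuple M)) (tnth a i) by exact: aA.
  by rewrite not_defset => -[c _ <-]; exists c.
split=> i.
  move=> j; rewrite -(fintype.splitK i) -(fintype.splitK j).
  case: (fintype.split i) => i'; case: (fintype.split j) => j' /=;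
    rewrite ?tnth_lshift ?tnth_rshift //.
  - by split=> [/xi ->|/yi ->].
  - by have [c ->] := aE j'; split=> /nX; case.
  - by have [c ->] := aE i'; split=> /esym /nX; case.
move=> c; rewrite -(fintype.splitK i); case: (fintype.split i) => i' /=;
  rewrite ?tnth_lshift ?tnth_rshift //.
by split=> /nX; case.
Qed.

Definition params n (a : n.-tuple M) (z : 'I_m + 'I_n) : M :=
  match z with inl c => b c | inr i => tnth a i end.

(** Two such elements have the same equality type over the parameters and the
    named points. *)
Lemma homogeneous_swap n (psi : formula L n.+1) (a : n.-tuple M) x y :
  (forall z, params a z <> x) -> (forall z, params a z <> y) ->
  defset psi a x -> defset psi a y.
Proof.
move=> hx hy.
suff : defset psi a x <-> defset psi a y by case.
apply: (sat_similar psi iM iM cb); split=> i.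
  move=> j; case: (unliftP ord0 i) => [i' ->|->];
    case: (unliftP ord0 j) => [j' ->|->]; rewrite ?tnth_cons0 ?tnth_consS //.
    by split=> [/(hx (inr _))|/(hy (inr _))].
  by split=> /esym => [/(hx (inr _))|/(hy (inr _))].
by move=> c; case: (unliftP ord0 i) => [i' ->|->];
  rewrite ?tnth_cons0 ?tnth_consS //; split=> /esym => [/(hx (inl c))|/(hy (inl c))].
Qed.

Lemma homogeneous_finite n (psi : formula L n.+1) (a : n.-tuple M) :
  finite_set (defset psi a) <->
  forall x, (forall z, params a z <> x) -> ~ defset psi a x.
Proof.
split=> [fin x hx px|h].
  have [y [_ hy] ny] := fresh_in (params a) (infinite_setD iM fin).
  exact/hy/(homogeneous_swap hx ny).
apply: (sub_finite_set _ (finite_range (params a))) => x px.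
by apply: contrapT => nx; apply: (h x) => // z e; apply: nx; exists z.
Qed.

(** All but finitely many elements are generic over the parameters, and these
    are either all in the definable set or all outside of it. *)
Lemma homogeneous_minimal n (psi : formula L n.+1) (a : n.-tuple M) :
  finite_set (defset psi a) \/ finite_set (~` defset psi a).
Proof.
case: (pselect (finite_set (defset psi a))) => [|inf]; [by left|right].
rewrite (_ : ~` defset psi a = defset (Not psi) a) //.
apply/homogeneous_finite => y hy; apply.
move/homogeneous_finite: inf => /existsNP [x] /not_implyP [hx] /contrapT px.
exact: homogeneous_swap hx hy px.
Qed.

Lemma acl_mono (X Y : set M) : X `<=` Y -> acl X `<=` acl Y.
Proof.
by move=> XY x [n [psi [a [aX fin px]]]]; exists n, psi, a; split=> // i;
  apply/XY/aX.
Qed.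

Lemma sub_acl (X : set M) : X `<=` acl X.
Proof.
move=> x Xx; exists 1, (Atom (inl (ord0, lift ord0 ord0))), [tuple x].
split=> [i| |//]; first by rewrite (ord1 i).
by apply: (sub_finite_set _ (finite_set1 x)) => y.
Qed.

(** A generic element that is not a parameter takes all the other ones along
    into any definable set, which is therefore infinite. *)
Lemma homogeneous_trivial_acl (X : set M) : acl X = X `|` acl set0.
Proof.
apply/seteqP; split=> x; last first.
  by case=> [/sub_acl //|]; apply: acl_mono.
case=> n [psi [a [aX fin px]]]; apply: contrapT => /not_orP [nX nacl].
apply: ((homogeneous_finite psi a).1 fin x _ px) => -[c|i] /= e; last first.
  by apply: nX; rewrite -e.
apply: nacl; exists 0, (Not phi), [tuple]; split=> [[]//||].
  have := finite_named; rewrite -not_defset; exact.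
by rewrite /defset /= cons_nil bphi; apply; exists c.
Qed.

End NamedPoints.

Lemma named_enum (A : Type) m (b : 'I_m -> A) : injective b ->
  [set: A] #= [set: nat] ->
  exists e : nat -> A, bijective e /\ forall c : 'I_m, e c = b c.
Proof.
move=> bi cA; have iA : infinite_set [set: A].
  by rewrite (eq_finite_set cA); exact: infinite_nat.
have [g [gi gX]] : exists g : nat -> A, injective g /\
    forall x, (~` range b) x <-> exists n, x = g n.
  apply: countable_enum; apply: eq_card_nat.
    apply: (sub_countable (card_leT _)).
    by rewrite (eq_countable cA).
  have := infinite_setD iA (finite_range b); rewrite setTD; exact.
have gb n c : g n <> b c.
  by move=> e; apply: ((gX (g n)).2 (ex_intro _ n erefl)); exists c.
exists (prepend b g); split=> [|c]; last exact: prepend_ord.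
rewrite -setTT_bijective; split=> //.
  by move=> i j _ _; exact: prepend_inj.
move=> x _; case: (pselect (range b x)) => [[c _ <-]|/gX [n ->]].
  by exists c => //; exact: prepend_ord.
by exists (m + n) => //; exact: prepend_addn.
Qed.

(** Any bijection that matches the named points preserves similarity, and hence
    the relations. *)
Lemma compatible_isomorphic (L : vocabulary) (M N : structure L) m
    (b : 'I_m -> M) (b' : 'I_m -> N) : injective b -> injective b' ->
  compatible b b' -> [set: M] #= [set: nat] -> [set: N] #= [set: nat] ->
  isomorphic M N.
Proof.
move=> bi bi' cbb' cM cN.
have [e [[e' eK e'K] eb]] := named_enum bi cM.
have [d [[d' dK d'K] db]] := named_enum bi' cN.
have fi : injective (d \o e') by apply: inj_comp; [exact: can_inj dK|exact: can_inj e'K].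
exists (d \o e'); split.
  by exists (e \o d') => x /=; rewrite ?dK ?e'K ?eK ?d'K.
move=> r v; apply: cbb'.2; split=> i j; rewrite !tnth_map.
  by split=> [->|/fi].
rewrite -db -eb /=; split=> [->|/(can_inj dK) <-]; first by rewrite eK.
by rewrite e'K.
Qed.

(** A countable model is obtained by restricting [M] to countably many elements
    including the named points; it is elementarily equivalent to [M] because it
    is compatible with [M] over these points. *)
Lemma homogeneous_categorical (L : vocabulary) (T : theory L) (M : structure L)
    (phi : formula L 1) : binary L -> complete T -> has_infinite_models T ->
  is_model T M -> homogeneous_model M phi -> omega_categorical T.
Proof.
move=> hL cT iT TM /(named_points hL cT iT TM) [m [b [bi cb bphi hb]]].
have iM := infinite_models cT iT TM.
split; first exact: infinite_models cT iT.
- have := infinite_setD iM (finite_range b); rewrite setTD.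
  move=> /infinite_enum [g [gi gX]].
  have pi : injective (prepend b g).
    by apply: prepend_inj => // n c e; apply: (gX n); exists c.
  have cbN := @pullback_compatible L M nat _ (prepend b g) (inhabits 0) b
    (fun c => c : nat) pi (fun c => esym (prepend_ord b g c)) cb.
  pose N := pullback (prepend b g) (inhabits 0).
  exists N; split; last exact: card_eqxx.
  move=> sigma /TM.
  have sim : similar b (fun c : 'I_m => c : nat) (tnth ([tuple] : 0.-tuple M))
    (tnth ([tuple] : 0.-tuple nat)) by split; case.
  exact: (sat_similar (N := N) sigma iM infinite_nat cbN sim).1.
- move=> N K TN TK cN cK.
  have [bN [cbN bNi _]] := hb N TN; have [bK [cbK bKi _]] := hb K TK.
  apply: (compatible_isomorphic bNi bKi _ cN cK).
  exact: (compatible_trans iM (compatible_sym cbN) cbK).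
Qed.

Section NamedPointsTheory.

Variables (L : vocabulary) (T : theory L) (M : structure L).
Variable phi : formula L 1.
Hypotheses (hL : binary L) (cT : complete T) (iT : has_infinite_models T).
Hypotheses (TM : is_model T M) (hM : homogeneous_model M phi).

Lemma named_points_in (N : structure L) : is_model T N ->
  exists m (b : 'I_m -> N),
    [/\ injective b, compatible b b &
        forall x, sat phi [tuple x] <-> ~ exists c, x = b c].
Proof.
move=> TN; have [m [b [bi cb bphi hb]]] := named_points hL cT iT TM hM.
have [b' [cb' bi' bphi']] := hb N TN; exists m, b'; split=> //.
exact: (compatible_trans (infinite_models cT iT TM) (compatible_sym cb') cb').
Qed.

Lemma minimal_categorical_trivial_of_homogeneous :
  [/\ strongly_minimal T, omega_categorical T & trivial_acl T].
Proof.
split; last 2 first.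
- exact: homogeneous_categorical hL cT iT TM hM.
- move=> N TN X; have [m [b [_ cb bphi]]] := named_points_in TN.
  exact: (homogeneous_trivial_acl (infinite_models cT iT TN) cb bphi).
move=> N TN n psi a; have [m [b [_ cb _]]] := named_points_in TN.
exact: (homogeneous_minimal (infinite_models cT iT TN) cb).
Qed.

Lemma indiscernible_of_homogeneous (N : structure L) : is_model T N ->
  exists psi : formula L 1,
    let X := defset psi ([tuple] : 0.-tuple N) in
    finite_set (~` X) /\ indiscernible_over X (~` X).
Proof.
move=> TN; have [m [b [_ cb bphi]]] := named_points_in TN.
exists phi; split; first by rewrite (not_defset bphi); exact: finite_named.
exact: (homogeneous_indiscernible (infinite_models cT iT TN) cb bphi).
Qed.

End NamedPointsTheory.

(** The entries outside of the finite set form the indiscernible tuple, those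
    inside are the parameters; [h] puts them back into their places. *)
Lemma homogeneous_of_indiscernible (L : vocabulary) (M : structure L)
    (phi : formula L 1) (X := defset phi ([tuple] : 0.-tuple M)) :
  finite_set (~` X) -> indiscernible_over X (~` X) -> homogeneous_model M phi.
Proof.
move=> fX ind; split=> //; rewrite -/X => p q p' q' e hp hq.
have notX x : ~ X x -> (~` X) x by [].
have agree x y : ((~` X) x \/ (~` X) y -> x = y) -> X x -> X y.
  by move=> h Xx; apply: contrapT => nX; move: (nX); rewrite -h //; right.
have inj1 (x : M) : injective (tnth [tuple x]) by move=> i j _; rewrite !ord1.
have X1 (x : M) : X x -> forall i, X (tnth [tuple x] i) by move=> ? i; rewrite ord1.
have nX1 (x : M) : ~ X x -> forall i, (~` X) (tnth [tuple x] i).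
  by move=> ? i; rewrite ord1.
have transfer n k (x y : n.-tuple M) (c : k.-tuple M) (h : 'I_2 -> 'I_(n + k)) :
    injective (tnth x) -> (forall i, X (tnth x i)) ->
    injective (tnth y) -> (forall i, X (tnth y i)) ->
    (forall i, (~` X) (tnth c i)) ->
    (forall i, tnth [tuple p; q] i = tnth [tuple of x ++ c] (h i)) ->
    (forall i, tnth [tuple p'; q'] i = tnth [tuple of y ++ c] (h i)) ->
    atDiag [tuple p; q] = atDiag [tuple p'; q'].
  move=> xi Xx yi Xy Xc epq epq'; apply/atDiag_eqP => a.
  have ex : [tuple tnth [tuple of x ++ c] (h i) | i < 2] = [tuple p; q].
    by apply: eq_from_tnth => i; rewrite tnth_mktuple epq.
  have ey : [tuple tnth [tuple of y ++ c] (h i) | i < 2] = [tuple p'; q'].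
    by apply: eq_from_tnth => i; rewrite tnth_mktuple epq'.
  have := ind _ _ _ xi Xx yi Xy _ _ Xc (rename (Atom a) h).
  by rewrite !sat_rename ex ey.
have [Xp|nXp] := pselect (X p); have [Xq|nXq] := pselect (X q).
- have Xp' := agree _ _ hp Xp; have Xq' := agree _ _ hq Xq.
  have [epq|npq] := pselect (p = q).
    have epq' := e.1 epq.
    apply: (transfer 1 0 [tuple p] [tuple p'] [tuple] (fun=> ord0)) => //;
      try exact: X1; try by case.
      by rewrite -epq; case=> [[|[|]]].
    by rewrite -epq'; case=> [[|[|]]].
  have inj2 (x y : M) : x <> y -> injective (tnth [tuple x; y]).
    by move=> ne; case=> [[|[|//]] i] [[|[|//]] j] // h; apply: val_inj;
      rewrite // ?(esym ne) //; case: ne.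
  have X2 (x y : M) : X x -> X y -> forall i, X (tnth [tuple x; y] i).
    by move=> ? ?; case=> [[|[|//]] i].
  apply: (transfer 2 0 [tuple p; q] [tuple p'; q'] [tuple] (lshift 0)) => //;
    try exact: inj2; try exact: X2; try by case.
  + by apply: inj2 => /e.
  + by move=> i; rewrite tnth_lshift.
  + by move=> i; rewrite tnth_lshift.
- have Xp' := agree _ _ hp Xp; have eq : q = q' by apply: hq; left.
  apply: (transfer 1 1 [tuple p] [tuple p'] [tuple q] id) => //;
    try exact: X1; try exact: nX1.
    by case=> [[|[|//]] i].
  by rewrite -eq; case=> [[|[|//]] i].
- have Xq' := agree _ _ hq Xq; have ep : p = p' by apply: hp; left.
  apply: (transfer 1 1 [tuple q] [tuple q'] [tuple p]
    (fun i => if i == ord0 then ord_max else ord0)) => //;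
    try exact: X1; try exact: nX1.
    by case=> [[|[|//]] i].
  by rewrite -ep; case=> [[|[|//]] i].
- by rewrite hp; [rewrite hq; [|left]|left].
Qed.

(** * Ultrapowers *)

Section Ultrapower.

Variables (L : vocabulary) (M : structure L) (U : set_system nat).
Hypothesis ultraU : UltraFilter U.

(** The quotient of sequences by equality almost everywhere: an element is the
    set of all sequences equivalent to a given one. *)
Definition ultra_carrier : Type :=
  {C : set (nat -> M) | exists f, C = [set g | U [set i | f i = g i]]}.

Definition ultra_class (f : nat -> M) : ultra_carrier :=
  exist _ [set g | U [set i | f i = g i]] (ex_intro _ f erefl).

Definition ultra_repr (c : ultra_carrier) : nat -> M :=
  projT1 (cid (proj2_sig c)).

Lemma ultra_inhabited : inhabited ultra_carrier.
Proof. by have [x] := structure_inhabited M; exists; exact: ultra_class. Qed.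

Definition ultrapower : structure L :=
  @Structure L ultra_carrier
    (fun r v => U [set i | interp M r [tuple ultra_repr (tnth v j) i | j < arity r]])
    ultra_inhabited.

Lemma ultra_refl (f : nat -> M) : U [set i | f i = f i].
Proof. by apply: filterS filterT. Qed.

Lemma ultra_carrierP (c : ultra_carrier) g :
  proj1_sig c g <-> U [set i | ultra_repr c i = g i].
Proof. by rewrite /ultra_repr; case: cid => f /= ->. Qed.

Lemma ultra_repr_class f : U [set i | ultra_repr (ultra_class f) i = f i].
Proof. by apply/ultra_carrierP; exact: ultra_refl. Qed.

Lemma ultra_repr_eq c d : U [set i | ultra_repr c i = ultra_repr d i] <-> c = d.
Proof.
split=> [h|->]; last exact: ultra_refl.
suff : proj1_sig c = proj1_sig d.
  by case: c d {h} => C pC [D pD] /= CD; exact: eq_exist.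
apply/seteqP; split=> g /=.
  move=> /ultra_carrierP cg; apply/ultra_carrierP.
  by apply: filterS (filterI h cg) => i /= [<-].
move=> /ultra_carrierP cg; apply/ultra_carrierP.
by apply: filterS (filterI h cg) => i /= [->].
Qed.

Lemma ultra_not (A : set nat) : U (~` A) <-> ~ U A.
Proof.
split=> [nA hA|nA]; last by case: (in_ultra_setVsetC A ultraU).
by have [i []] := filter_ex (filterI hA nA).
Qed.

(** The theorem of Los.  Witnesses of an existential formula, chosen index by
    index where they exist, form a sequence and thus an element. *)
Lemma sat_ultrapower n (phi : formula L n) (v : n.-tuple ultrapower) :
  sat phi v <-> U [set i | sat phi [tuple ultra_repr (tnth v j) i | j < n]].
Proof.
elim: phi v => {n} [n a|n psi IH|n psi IH1 chi IH2|n psi IH] v /=.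
- case: a => [[i j]|[r w]] /=.
    rewrite -ultra_repr_eq (_ : [set k | _] = [set k |
      tnth [tuple ultra_repr (tnth v j) k | j < n] i =
      tnth [tuple ultra_repr (tnth v j) k | j < n] j]) //.
    by apply/funext => k /=; rewrite !tnth_mktuple.
  rewrite (_ : [set i | _] = [set i | interp M r
    [tuple of map (tnth [tuple ultra_repr (tnth v j) i | j < n]) w]]) //.
  apply/funext => i /=; congr (interp M r _).
  by apply: eq_from_tnth => j; rewrite tnth_mktuple !tnth_map tnth_ord_tuple.
- by rewrite IH -ultra_not.
- rewrite IH1 IH2; split=> [[h k]|h]; first by apply: filterS (filterI h k).
  by split; apply: filterS h => i [].
have e (c : ultrapower) i : [tuple ultra_repr (tnth [tuple of c :: v] j) i | j < n.+1] =
    [tuple of ultra_repr c i :: [tuple ultra_repr (tnth v j) i | j < n]].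
  apply: eq_from_tnth => k; rewrite tnth_mktuple; case: (unliftP ord0 k) => [j ->|->].
    by rewrite !tnth_consS tnth_mktuple.
  by rewrite !tnth_cons0.
split=> [[c /IH h]|h].
  by apply: filterS h => i /=; rewrite e => h; exists (ultra_repr c i).
have /choice [g hg] : forall i, exists x,
    (exists y, sat psi [tuple of y :: [tuple ultra_repr (tnth v j) i | j < n]]) ->
    sat psi [tuple of x :: [tuple ultra_repr (tnth v j) i | j < n]].
  move=> i; case: (pselect (exists y, sat psi
    [tuple of y :: [tuple ultra_repr (tnth v j) i | j < n]])) => [[y hy]|ny].
    by exists y.
  by have [x] := structure_inhabited M; exists x.
exists (ultra_class g); apply/IH.
apply: filterS (filterI h (ultra_repr_class g)) => i /= [/hg hi ei].
by rewrite e ei.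
Qed.

Lemma ultrapower_model (T : theory L) : is_model T M -> is_model T ultrapower.
Proof.
move=> TM sigma /TM h; apply/sat_ultrapower; apply: filterS filterT => i _ /=.
by rewrite (_ : [tuple _ | _ < 0] = [tuple]) //; exact: tuple0.
Qed.

Definition ultra_diag (x : M) : ultrapower := ultra_class (fun=> x).

Lemma ultra_repr1 (c : ultrapower) i :
  [tuple ultra_repr (tnth [tuple c] j) i | j < 1] = [tuple ultra_repr c i].
Proof. by apply: eq_from_tnth => j; rewrite tnth_mktuple !ord1. Qed.

Lemma sat_ultra_diag (psi : formula L 1) x :
  sat psi [tuple ultra_diag x] <-> sat psi [tuple x].
Proof.
rewrite sat_ultrapower; split=> h.
  have [i /= [hi ei]] := filter_ex (filterI h (ultra_repr_class (fun=> x))).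
  by move: hi; rewrite ultra_repr1 ei.
by apply: filterS (ultra_repr_class (fun=> x)) => i /= e; rewrite ultra_repr1 e.
Qed.

Lemma ultra_diag_inj : injective ultra_diag.
Proof.
move=> x y /ultra_repr_eq h.
have [i /= [ei [ex ey]]] := filter_ex (filterI h
  (filterI (ultra_repr_class (fun=> x)) (ultra_repr_class (fun=> y)))).
by rewrite -ex -ey.
Qed.

(** A sequence with values in a finite set is constant almost everywhere, since
    an ultrafilter contains a member of each finite covering. *)
Lemma ultra_finite (psi : formula L 1) (c : ultrapower) :
  finite_set [set x : M | sat psi [tuple x]] -> sat psi [tuple c] ->
  exists x, c = ultra_diag x.
Proof.
case/finite_enum => m [b [_ bP]] /sat_ultrapower h; apply: contrapT => nc.
have hk (k : 'I_m) : U [set i | ultra_repr c i <> b k].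
  apply/ultra_not => hk; apply: nc; exists (b k); apply/ultra_repr_eq.
  by apply: filterS (filterI hk (ultra_repr_class (fun=> b k))) => i /= [-> ->].
have [i [/=]] := filter_ex (filterI h (filter_forall _ hk)).
by rewrite ultra_repr1 => /bP [k e] /(_ k).
Qed.

End Ultrapower.

(** * The algebraic closure of the empty set is finite *)

Lemma defset0E (L : vocabulary) (M : structure L) (psi : formula L 1)
    (a : 0.-tuple M) : defset psi a = [set y | sat psi [tuple y]].
Proof.
by rewrite (tuple0 a); apply/seteqP; split=> y; rewrite /defset /= cons_nil.
Qed.

Lemma acl0P (L : vocabulary) (M : structure L) (x : M) :
  acl set0 x <-> exists psi : formula L 1,
    finite_set [set y : M | sat psi [tuple y]] /\ sat psi [tuple x].
Proof.
split=> [[[|n] [psi [a [a0 fin px]]]]|[psi [fin px]]].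
- by exists psi; move: fin px; rewrite defset0E.
- by case: (a0 ord0).
- by exists 0, psi, [tuple]; rewrite defset0E; split=> // -[].
Qed.

Fixpoint encode (L : vocabulary) n (phi : formula L n) : GenTree.tree nat :=
  match phi with
  | Atom _ a => GenTree.Leaf (pickle a)
  | Not _ psi => GenTree.Node 0 [:: encode psi]
  | And _ psi chi => GenTree.Node 1 [:: encode psi; encode chi]
  | Ex _ psi => GenTree.Node 2 [:: encode psi]
  end.

Fixpoint decode (L : vocabulary) (t : GenTree.tree nat) n : option (formula L n) :=
  match t with
  | GenTree.Leaf k => omap (@Atom L n) (unpickle k)
  | GenTree.Node 0 [:: s] => omap (@Not L n) (decode L s n)
  | GenTree.Node 1 [:: s; r] =>
      if decode L s n is Some psi then omap (And psi) (decode L r n) else None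
  | GenTree.Node 2 [:: s] => omap (@Ex L n) (decode L s n.+1)
  | _ => None
  end.

Lemma encodeK (L : vocabulary) n (phi : formula L n) :
  decode L (encode phi) n = Some phi.
Proof.
elim: phi => {n} [n a|n psi IH|n psi IH1 chi IH2|n psi IH] /=.
- by rewrite pickleK.
- by rewrite IH.
- by rewrite IH1 IH2.
- by rewrite IH.
Qed.

Lemma countable_formula (L : vocabulary) n (S : set (formula L n)) : countable S.
Proof.
apply/countable_injP; exists (fun phi => pickle (encode phi)) => phi psi _ _.
move=> /(pcan_inj pickleK) e; have := encodeK phi.
by rewrite e encodeK => -[].
Qed.

(** There are countably many formulas, and each contributes finitely many
    elements. *)
Lemma countable_acl0 (L : vocabulary) (M : structure L) :
  countable (acl (set0 : set M)).
Proof.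
pose F (psi : formula L 1) := [set y : M | sat psi [tuple y]].
rewrite (_ : acl set0 = \bigcup_(psi in [set psi | finite_set (F psi)]) F psi).
  apply: bigcup_countable => [|psi /= fin]; first exact: countable_formula.
  exact: finite_set_countable.
apply/seteqP; split=> x; first by move=> /acl0P [psi [fin px]]; exists psi.
by case=> psi fin px; apply/acl0P; exists psi.
Qed.

(** In a strongly minimal structure an infinite algebraically closed set is an
    elementary substructure: a definable set either is finite, and then part of
    the closed set, or cofinite, and then meets it. *)
Lemma sat_closed (L : vocabulary) (M : structure L) (A : Type) (f : A -> M)
    (iA : inhabited A) n (phi : formula L n)
    (v : n.-tuple (pullback f iA)) :
  (forall k (psi : formula L k.+1) (a : k.-tuple M),
     finite_set (defset psi a) \/ finite_set (~` defset psi a)) ->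
  injective f -> infinite_set (range f) -> acl (range f) `<=` range f ->
  sat phi v <-> sat phi [tuple of map f v].
Proof.
move=> min fi iF cl; elim: phi v => {n} [n a|n psi IH|n psi IH1 chi IH2|n psi IH] v /=.
- case: a => [[i j]|[r w]] /=; first by rewrite !tnth_map; split=> [->|/fi].
  rewrite (_ : [tuple of map f _] = [tuple of map (tnth [tuple of map f v]) w]) //.
  by apply: eq_from_tnth => i; rewrite !tnth_map.
- by rewrite IH.
- by rewrite IH1 IH2.
have e (y : A) : [tuple of map f [tuple of y :: v]] =
    [tuple of f y :: [tuple of map f v]] by exact: val_inj.
split=> [[y /IH h]|[x hx]]; first by exists (f y); rewrite -e.
suff [y hy] : exists y, sat psi [tuple of f y :: [tuple of map f v]].
  by exists y; apply/IH; rewrite e.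
have [fin|cof] := min _ psi [tuple of map f v].
  have [|y _ ey] := cl x; last by exists y; rewrite ey.
  exists n, psi, [tuple of map f v]; split=> // i; rewrite tnth_map; by exists (tnth v i).
have [_ [[y _ <-] ny]] := infinite_setN0 (infinite_setD iF cof).
by exists y; apply: contrapT => h; exact: ny.
Qed.

Lemma sat_isomorphism (L : vocabulary) (M N : structure L) (f : M -> N) n
    (phi : formula L n) (v : n.-tuple M) : bijective f ->
  (forall r (u : (arity r).-tuple M), interp M r u <-> interp N r [tuple of map f u]) ->
  sat phi v <-> sat phi [tuple of map f v].
Proof.
move=> [g fK gK] fr; elim: phi v => {n} [n a|n psi IH|n psi IH1 chi IH2|n psi IH] v /=.
- case: a => [[i j]|[r w]] /=; first by rewrite !tnth_map; split=> [->|/(can_inj fK)].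
  rewrite fr (_ : [tuple of map f _] = [tuple of map (tnth [tuple of map f v]) w]) //.
  by apply: eq_from_tnth => i; rewrite !tnth_map.
- by rewrite IH.
- by rewrite IH1 IH2.
have e (y : M) : [tuple of map f [tuple of y :: v]] =
    [tuple of f y :: [tuple of map f v]] by exact: val_inj.
split=> [[y /IH h]|[x hx]]; first by exists (f y); rewrite -e.
by exists (g x); apply/IH; rewrite e gK.
Qed.

(** The infinite closure is a countable model all of whose elements are
    algebraic.  A non-algebraic element could be added to it, since by
    triviality the larger set is still closed; this would give a countable model
    of a different isomorphism type. *)
Lemma acl0_full (L : vocabulary) (T : theory L) (M : structure L) :
  strongly_minimal T -> omega_categorical T -> trivial_acl T ->
  is_model T M -> infinite_set (acl (set0 : set M)) -> forall c : M, acl set0 c.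
Proof.
move=> smT [_ _ catT] triv TM inf c; apply: contrapT => nc.
have [g [gi gP]] := countable_enum (eq_card_nat (countable_acl0 M) inf).
have gR : range g = acl set0.
  by apply/seteqP; split=> x; [case=> n _ <-; apply/gP; exists n|
    case/gP => n ->; exists n].
pose h := prepend (fun _ : 'I_1 => c) g.
have hi : injective h.
  apply: prepend_inj gi _ => [i j|n _ e]; first by rewrite !ord1.
  by apply: nc; apply/gP; exists n.
have h0 : h 0 = c by exact: (prepend_ord (fun _ : 'I_1 => c) g ord0).
have hR : range h = c |` acl set0.
  rewrite -gR; apply/seteqP; split=> x.
    case=> n _ <-; case: (ord_or_addn 1 n) => -[k ->]; rewrite /h.
      by rewrite prepend_ord; left.
    by rewrite prepend_addn; right; exists k.
  case=> [->|[n _ <-]]; first by exists 0.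
  by exists (1 + n) => //; rewrite /h prepend_addn.
have elem (f : nat -> M) (fi : injective f) (X : set M) :
    range f = X `|` acl set0 ->
    forall n (phi : formula L n) (v : n.-tuple (pullback f (inhabits 0))),
      sat phi v <-> sat phi [tuple of map f v].
  move=> fX n phi v; apply: sat_closed => //; first exact: smT.
    by apply: sub_infinite_set inf; rewrite fX; right.
  by rewrite (triv _ TM) {1}fX fX => x [|]; [|right].
have eg := elem g gi set0; rewrite set0U in eg; have {}eg := eg gR.
have eh := elem h hi [set c] hR.
have model (f : nat -> M) (ef : forall n (phi : formula L n)
    (v : n.-tuple (pullback f (inhabits 0))), sat phi v <-> sat phi [tuple of map f v]) :
    is_model T (pullback f (inhabits 0)).
  move=> sigma /TM s; apply/ef; rewrite (_ : [tuple of map _ _] = [tuple]) //.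
  exact: val_inj.
have [] := catT _ _ (model g eg) (model h eh) (card_eqxx _) (card_eqxx _).
move=> f [fbij fr]; have [f' fK f'K] := fbij.
have : acl set0 (g (f' 0)) by apply/gP; exists (f' 0).
case/acl0P => psi [fin ps]; apply: nc; apply/acl0P; exists psi; split=> //.
have one (A B : Type) (k : A -> B) (x : A) : [tuple of map k [tuple x]] = [tuple k x].
  exact: val_inj.
move: ps; rewrite -(one _ _ g) -(eg _ psi [tuple f' 0]).
rewrite (sat_isomorphism psi [tuple f' 0] fbij fr) one f'K.
by rewrite (eh _ psi [tuple 0]) one h0.
Qed.

(** The class of an injective sequence is not algebraic: otherwise the sequence
    would be constant almost everywhere, and it takes each value once. *)
Lemma acl0_ultrapower (L : vocabulary) (M : structure L) (U : set_system nat)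
    (uU : UltraFilter U) : \oo `<=` U -> infinite_set [set: M] ->
  exists c : ultrapower M U, ~ acl set0 c.
Proof.
move=> oU /infinite_enum [g [gi _]]; exists (ultra_class U g).
move=> /acl0P [psi [fin pg]].
have {}fin : finite_set [set x : M | sat psi [tuple x]].
  apply: sub_finite_set (finite_preimage (in2W (@ultra_diag_inj _ _ _ uU)) fin).
  by move=> x /= px; apply/(sat_ultra_diag uU).
have [x /(ultra_repr_eq uU) e] := ultra_finite uU fin pg.
have {}e : U [set i | g i = x].
  apply: filterS (filterI e (filterI (ultra_repr_class uU g)
    (ultra_repr_class uU (fun=> x)))).
  by move=> i /= [-> [<- ->]].
have [k gk] : exists k, g k = x by have [k] := filter_ex e; exists k.
have : U [set i | k < i] by apply: oU; exists k.+1.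
by move=> /(filterI e) /filter_ex [i /= []]; rewrite -gk => /gi ->; rewrite ltnn.
Qed.

(** Passing to an ultrapower keeps the closure infinite, by the diagonal
    embedding, and adds a non-algebraic element, against [acl0_full]. *)
Lemma acl0_finite (L : vocabulary) (T : theory L) (M : structure L) :
  complete T -> has_infinite_models T ->
  strongly_minimal T -> omega_categorical T -> trivial_acl T ->
  is_model T M -> finite_set (acl (set0 : set M)).
Proof.
move=> cT iT smT catT triv TM; apply: contrapT => inf.
have [U [uU oU]] := ultraFilterLemma eventually_filter.
have TN : is_model T (ultrapower M U) by exact: ultrapower_model.
have [c nc] := acl0_ultrapower uU oU (infinite_models cT iT TM).
apply/nc/(acl0_full smT catT triv TN) => fin; apply: inf.
apply: sub_finite_set (finite_preimage (in2W (@ultra_diag_inj L M U uU)) fin).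
move=> x /acl0P [psi [finp px]]; apply/acl0P; exists psi.
split; last exact/(sat_ultra_diag uU).
apply: sub_finite_set (finite_image (ultra_diag U) finp) => d pd.
have [y e] := ultra_finite uU finp pd; exists y => //.
by move: pd; rewrite /= e => /(sat_ultra_diag uU).
Qed.

(** * Strongly minimal theories with trivial algebraic closure *)

Lemma atDiag_flip (L : vocabulary) (M N : structure L) (p q : M) (p' q' : N) :
  atDiag [tuple p; q] = atDiag [tuple p'; q'] ->
  atDiag [tuple q; p] = atDiag [tuple q'; p'].
Proof.
pose h (i : 'I_2) : 'I_2 := if i == ord0 then ord_max else ord0.
have hE (A : Type) (x y : A) : [tuple tnth [tuple x; y] (h i) | i < 2] = [tuple y; x].
  by apply: eq_from_tnth; case=> [[|[|//]] i]; rewrite tnth_mktuple.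
by move=> /(atDiag_subst h); rewrite !hE.
Qed.

Lemma atDiag_diag (L : vocabulary) (M N : structure L) (p q : M) (p' q' : N) :
  atDiag [tuple p; q] = atDiag [tuple p'; q'] ->
  atDiag [tuple p; p] = atDiag [tuple p'; p'].
Proof.
pose h (i : 'I_2) : 'I_2 := ord0.
have hE (A : Type) (x y : A) : [tuple tnth [tuple x; y] (h i) | i < 2] = [tuple x; x].
  by apply: eq_from_tnth; case=> [[|[|//]] i]; rewrite tnth_mktuple.
by move=> /(atDiag_subst h); rewrite !hE.
Qed.

(** A definable set is finite or cofinite, and triviality puts the points of
    the finite side among the parameters and the algebraic points. *)
Lemma minimal_swap (L : vocabulary) (T : theory L) (M : structure L) n
    (psi : formula L n.+1) (a : n.-tuple M) x y :
  strongly_minimal T -> trivial_acl T -> is_model T M ->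
  ~ acl set0 x -> (forall i, tnth a i <> x) ->
  ~ acl set0 y -> (forall i, tnth a i <> y) ->
  defset psi a x -> defset psi a y.
Proof.
move=> smT triv TM nx ax ny ay px.
have out (chi : formula L n.+1) z : finite_set (defset chi a) -> ~ acl set0 z ->
    (forall i, tnth a i <> z) -> ~ defset chi a z.
  move=> fin nz az pz; have : acl (range (tnth a)) z.
    by exists n, chi, a; split=> // i; exists i.
  by rewrite (triv M TM) => -[[i _] /az|].
have [fin|cof] := smT M TM _ psi a; first by case: (out psi x).
by apply: contrapT; exact: (out (Not psi) y).
Qed.

(** The algebraic points are the named ones.  A pair of other points is moved to
    any other such pair one entry at a time; the detour through a fresh [z]
    keeps the two entries distinct on the way. *)
Lemma minimal_homogeneous (L : vocabulary) (T : theory L) (M : structure L) :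
  complete T -> has_infinite_models T ->
  strongly_minimal T -> omega_categorical T -> trivial_acl T ->
  is_model T M -> exists phi, homogeneous_model M phi.
Proof.
move=> cT iT smT catT triv TM.
have fA := acl0_finite cT iT smT catT triv TM.
have [m [b [_ bP]]] := finite_enum fA.
have /choice [psi psiP] : forall c, exists psi : formula L 1,
    finite_set [set y : M | sat psi [tuple y]] /\ sat psi [tuple b c].
  by move=> c; apply/acl0P/bP; exists c.
have [phi hphi] := definable_forall (fun c => definable_not (definable_sat (psi c))).
exists phi; rewrite /homogeneous_model.
have -> : ~` defset phi [tuple] = acl (set0 : set M).
  rewrite defset0E; apply/seteqP; split=> x /=; rewrite hphi.
    move=> /existsNP [c /contrapT px]; apply/acl0P; exists (psi c).
    by split=> //; case: (psiP c).
  by case/bP => c -> /(_ c); apply; case: (psiP c).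
split=> // p q p' q' e hp hq.
have swap (x z r : M) : ~ acl set0 x -> ~ acl set0 z -> r <> x -> r <> z ->
    atDiag [tuple x; r] = atDiag [tuple z; r].
  move=> nx nz rx rz.
  have [chi hchi] := definable_diag_eq (atDiag [tuple x; r]).
  suff : defset chi [tuple r] z.
    by rewrite /defset /= (_ : [tuple of _] = [tuple z; r]) ?hchi //; exact: val_inj.
  apply: (minimal_swap smT triv TM nx _ nz).
  - by move=> i; rewrite ord1.
  - by move=> i; rewrite ord1.
  by rewrite /defset /= (_ : [tuple of _] = [tuple x; r]) ?hchi //; exact: val_inj.
have agree (x y : M) : (acl set0 x \/ acl set0 y -> x = y) -> ~ acl set0 x -> ~ acl set0 y.
  by move=> h nx ay; apply: nx; rewrite h //; right.
have neq (x y : M) : acl set0 x -> ~ acl set0 y -> x <> y by move=> ax ny exy; rewrite exy in ax.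
have [ap|np] := pselect (acl set0 p); have [aq|nq] := pselect (acl set0 q).
- by rewrite hp; [rewrite hq; [|left]|left].
- rewrite -hp; last by left.
  have nq' := agree _ _ hq nq.
  by apply/atDiag_flip/swap => //; exact: neq.
- rewrite -hq; last by left.
  have np' := agree _ _ hp np.
  by apply/swap => //; exact: neq.
have np' := agree _ _ hp np; have nq' := agree _ _ hq nq.
have iA : infinite_set (~` acl (set0 : set M)).
  have := infinite_setD (infinite_models cT iT TM) fA; rewrite setTD; exact.
have [z nz zf] := fresh_in (tnth [tuple p; q; p'; q']) iA.
have {zf} [zp zq zp' zq'] : [/\ p <> z, q <> z, p' <> z & q' <> z].
  split.
  - exact: (zf (@Ordinal 4 0 isT)).
  - exact: (zf (@Ordinal 4 1 isT)).
  - exact: (zf (@Ordinal 4 2 isT)).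
  - exact: (zf (@Ordinal 4 3 isT)).
have [epq|npq] := pselect (p = q).
  rewrite -epq -(e.1 epq).
  by apply: (@atDiag_diag _ _ _ _ z _ z); apply: swap => // /esym.
have np'q' : p' <> q' by move/e.
rewrite (swap p z q) //; last exact: nesym.
rewrite (@atDiag_flip _ _ _ q z q' z); last by apply: swap => // /esym.
by apply: swap => //; exact: nesym.
Qed.

(** * The restricted equivalence relation of the named points *)

Lemma atDiag_pair_eq (L : vocabulary) (M : structure L) (p q : M) :
  inl (ord0, ord_max) \in atDiag [tuple p; q] <-> p = q.
Proof. by rewrite atDiagE. Qed.

(** The named points are isolated, all the others are related. *)
Lemma named_relation (L : vocabulary) (phi : formula L 1) :
  exists xi : formula L 2, forall (M : structure L) (x y : M),
    sat xi [tuple x; y] <-> x = y \/ sat phi [tuple x] /\ sat phi [tuple y].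
Proof.
have [xi hxi] := definable_or (definable_sat (Atom (L := L) (inl (ord0, ord_max))))
  (definable_and (definable_subst (fun _ : 'I_1 => ord0 : 'I_2) (definable_sat phi))
     (definable_subst (fun _ : 'I_1 => ord_max : 'I_2) (definable_sat phi))).
exists xi => M x y; rewrite hxi.
have e1 : [tuple tnth [tuple x; y] ord0 | _ < 1] = [tuple x].
  by apply: eq_from_tnth => i; rewrite tnth_mktuple !ord1.
have e2 : [tuple tnth [tuple x; y] ord_max | _ < 1] = [tuple y].
  by apply: eq_from_tnth => i; rewrite tnth_mktuple !ord1.
by rewrite e1 e2.
Qed.

Section NamedRelation.

Variables (L : vocabulary) (M : structure L) (m : nat) (b : 'I_m -> M).
Variables (phi : formula L 1) (xi : formula L 2).
Hypotheses (iM : infinite_set [set: M]) (bi : injective b).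
Hypothesis bphi : forall x, sat phi [tuple x] <-> ~ exists c, x = b c.
Hypothesis xiE : forall x y : M,
  sat xi [tuple x; y] <-> x = y \/ sat phi [tuple x] /\ sat phi [tuple y].

Lemma eqclass_named c : eqclass xi (b c) = [set b c].
Proof.
apply/seteqP; split=> x; rewrite /eqclass /= xiE.
  by case=> [->//|[/bphi h]]; case: h; exists c.
by move=> ->; left.
Qed.

Lemma eqclass_generic x : ~ (exists c, x = b c) -> eqclass xi x = ~` range b.
Proof.
move=> nx; apply/seteqP; split=> y; rewrite /eqclass /= xiE.
  case=> [<-|[_ /bphi h]] [c _ e]; first by apply: nx; exists c.
  by apply: h; exists c.
by move=> ny; right; split; apply/bphi => // -[c e]; apply: ny; exists c.
Qed.

Lemma infinite_generic : infinite_set (~` range b).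
Proof. by have := infinite_setD iM (finite_range b); rewrite setTD; exact. Qed.

Lemma base_named x : in_base_set xi x <-> exists c, x = b c.
Proof.
split=> [|[c ->]]; last exact: eqclass_named.
rewrite /in_base_set => e; apply: contrapT => nx.
apply: infinite_generic; rewrite -(eqclass_generic nx) e; exact: finite_set1.
Qed.

Lemma named_equivalence : let classes := range (@eqclass L M xi) in
  [/\ RelationClasses.Equivalence (fun x y : M => sat xi [tuple x; y]),
      forall C, classes C -> infinite_set C \/ exists a, C = [set a],
      [set C | classes C /\ infinite_set C] #= `I_1 &
      [set C | classes C /\ exists a, C = [set a]] #= `I_m].
Proof.
move=> classes.
split.
- split=> [x|x y|x y z]; rewrite !xiE; first by left.
    by case=> [->|[? ?]]; [left|right].
  by case=> [->//|[px py]] [<-|[_ pz]]; right.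
- move=> _ [x _ <-]; case: (pselect (exists c, x = b c)) => [[c ->]|nx].
    by right; exists (b c); exact: eqclass_named.
  by left; rewrite (eqclass_generic nx); exact: infinite_generic.
- rewrite (_ : [set C | _] = [set ~` range b]); first exact: card_set1.
  apply/seteqP; split=> [C [[x _ <-] iC]|_ ->] /=.
    case: (pselect (exists c, x = b c)) => [[c e]|]; last exact: eqclass_generic.
    by case: iC; rewrite e eqclass_named; exact: finite_set1.
  split; last exact: infinite_generic.
  have [x nx] := infinite_setN0 infinite_generic.
  by exists x => //; apply: eqclass_generic => -[c e]; apply: nx; exists c.
- rewrite (_ : [set C | _] = [set [set b c] | c in [set: 'I_m]]).
    apply: (card_eq_trans (inj_card_eq _) (card_esym card_II)).
    by move=> c d _ _ /seteqP [/(_ (b c) erefl) /bi].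
  apply/seteqP; split=> [C [[x _ <-] [a ea]]|_ [c _ <-]].
    case: (pselect (exists c, x = b c)) => [[c e]|nx].
      by exists c => //; rewrite e eqclass_named.
    exfalso; apply: infinite_generic; rewrite -(eqclass_generic nx) ea.
    exact: finite_set1.
  split; last by exists (b c).
  by exists (b c) => //; exact: eqclass_named.
Qed.

Lemma same_pair_generic (x y x' y' : M) : compatible b b ->
  ~ in_base_set xi x -> ~ in_base_set xi y ->
  ~ in_base_set xi x' -> ~ in_base_set xi y' -> x <> y -> x' <> y' ->
  atDiag [tuple x; y] = atDiag [tuple x'; y'].
Proof.
move=> cb; rewrite !base_named => nx ny nx' ny' xy xy'.
apply: (atDiag_similar iM iM cb); apply/similar_pair; split=> [//|c|c].
  by split=> e; [case: nx|case: nx']; exists c.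
by split=> e; [case: ny|case: ny']; exists c.
Qed.

End NamedRelation.

(** * Extension axioms over the named points *)

Lemma tuple_pair (A : Type) n (v : n.-tuple A) (x0 : A) : n <= 2 ->
  exists p q (h : 'I_n -> 'I_2), forall i, tnth v i = tnth [tuple p; q] (h i).
Proof.
case: n v => [|[|[|//]]] v _.
- by exists x0, x0, (fun=> ord0) => -[].
- by exists (tnth v ord0), x0, (fun=> ord0) => i; rewrite ord1.
- by exists (tnth v ord0), (tnth v ord_max), id => i; rewrite -pairE.
Qed.

(** Each atomic formula mentions at most two entries.  The tuple is nonempty so
    that there is a pair which sees the nullary relations. *)
Lemma atDiag_of_pairs (L : vocabulary) (M N : structure L) k (y : k.-tuple M)
    (y' : k.-tuple N) : binary L -> 0 < k ->
  (forall r s, atDiag [tuple tnth y r; tnth y s] =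
               atDiag [tuple tnth y' r; tnth y' s]) ->
  atDiag y = atDiag y'.
Proof.
move=> hL k0 e; apply/atDiag_eqP => -[[i j]|[r w]].
  have /atDiag_eqP := e i j; exact: (fun h => h (inl (ord0, ord_max))).
have [p [q [h hE]]] := tuple_pair w (Ordinal k0) (hL r).
have /atDiag_eqP := e p q.
move=> /(_ (inr (existT _ r [tuple h i | i < arity r]))) /=.
have eE (K : structure L) (z : k.-tuple K) :
    [tuple of map (tnth [tuple tnth z p; tnth z q]) [tuple h i | i < arity r]] =
    [tuple of map (tnth z) w].
  apply: eq_from_tnth => i; rewrite !tnth_map tnth_ord_tuple hE.
  by case: (h i) => -[|[|//]] ?.
by have := eE M y; have := eE N y'; rewrite /= => -> ->.
Qed.

Lemma sat_extension_axiom (L : vocabulary) N (gamma0 : formula L N) k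
    (theta : formula L (N + k)) (M : structure L) (y : k.-tuple M) :
  sat (extension_axiom gamma0 theta) y <->
  exists x : N.-tuple M, sat gamma0 x /\ sat theta [tuple of x ++ y].
Proof.
rewrite /extension_axiom sat_exs /=.
have e (x : N.-tuple M) : [tuple tnth [tuple of x ++ y] (lshift k i) | i < N] = x.
  by apply: eq_from_tnth => i; rewrite tnth_mktuple tnth_lshift.
by split=> -[x]; [rewrite sat_rename e; exists x|exists x; rewrite sat_rename e].
Qed.

Lemma definable_expresses (L : vocabulary) (xi : formula L 2) l
    (t : 'I_l -> nat) k (d : index_data L l k) :
  exists theta : formula L (nvars t + k), expresses xi d theta.
Proof.
pose hy (r s : 'I_k) (i : 'I_2) : 'I_(nvars t + k) :=
  if i == ord0 then rshift (nvars t) r else rshift (nvars t) s.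
pose hx (r : 'I_k) (i : 'I_2) : 'I_(nvars t + k) :=
  if i == ord0 then rshift (nvars t) r else lshift k (@xvar l t (d.1 r) ord0).
have [theta h] := definable_and
  (definable_forall (fun r => definable_forall (fun s =>
     definable_subst (hy r s) (definable_diag_eq (d.2 r s)))))
  (definable_forall (fun r => definable_subst (hx r) (definable_sat xi))).
exists theta => M x y; rewrite h.
have ey r s : [tuple tnth [tuple of x ++ y] (hy r s i) | i < 2] =
    [tuple tnth y r; tnth y s].
  by apply: eq_from_tnth; case=> [[|[|//]] i]; rewrite tnth_mktuple tnth_rshift.
have ex r : [tuple tnth [tuple of x ++ y] (hx r i) | i < 2] =
    [tuple tnth y r; tnth x (@xvar l t (d.1 r) ord0)].
  by apply: eq_from_tnth; case=> [[|[|//]] i]; rewrite tnth_mktuple ?tnth_rshift ?tnth_lshift.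
split=> -[hd hc]; split=> [r s|r].
- by rewrite -ey; exact: hd.
- by rewrite -ex; exact: hc.
- by rewrite ey; exact: hd.
- by rewrite ex; exact: hc.
Qed.

Lemma similar_cat (A B : Type) n k (u : n.-tuple A) (x : n.-tuple B)
    (v : k.-tuple A) (y : k.-tuple B) :
  (forall i j, tnth u i = tnth u j <-> tnth x i = tnth x j) ->
  similar (tnth u) (tnth x) (tnth v) (tnth y) ->
  similar (tnth u) (tnth x) (tnth [tuple of u ++ v]) (tnth [tuple of x ++ y]).
Proof.
move=> ux [vy vyu]; split=> i.
  move=> j; rewrite -(fintype.splitK i) -(fintype.splitK j).
  case: (fintype.split i) => i'; case: (fintype.split j) => j' /=;
    rewrite ?tnth_lshift ?tnth_rshift //.
  by split=> /esym /vyu.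
by move=> j; rewrite -(fintype.splitK i); case: (fintype.split i) => i' /=;
  rewrite ?tnth_lshift ?tnth_rshift.
Qed.

Lemma similar_rcons (A B : Type) (C : finType) (b : C -> A) (b' : C -> B) n
    (v : n.-tuple A) (w : n.-tuple B) (x : A) :
  (forall c d, b c = b d <-> b' c = b' d) -> infinite_set [set: B] ->
  similar b b' (tnth v) (tnth w) ->
  exists y, similar b b' (tnth [tuple of rcons v x]) (tnth [tuple of rcons w y]).
Proof.
move=> bb' iB sim; have [y sim'] := similar_cons x bb' iB sim; exists y.
pose h (i : 'I_n.+1) : 'I_n.+1 :=
  if unlift ord_max i is Some j then lift ord0 j else ord0.
have hE (D : Type) (z : n.-tuple D) (a : D) i :
    tnth [tuple of rcons z a] i = tnth [tuple of a :: z] (h i).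
  rewrite /h; case: (unliftP ord_max i) => [j ->|->]; last first.
    by rewrite tnth_rcons_max tnth_cons0.
  rewrite (_ : lift ord_max j = widen_ord (leqnSn n) j) ?tnth_rcons_widen ?tnth_consS //.
  by apply: val_inj; exact: lift_max.
by apply: (similar_reindex sim') => i; exact: hE.
Qed.

Section NamedExtensions.

Variables (L : vocabulary) (M : structure L) (m : nat) (b : 'I_m -> M).
Variables (phi : formula L 1) (xi : formula L 2) (x0 x1 : M).
Hypotheses (hL : binary L) (iM : infinite_set [set: M]).
Hypotheses (bi : injective b) (cb : compatible b b).
Hypothesis bphi : forall x, sat phi [tuple x] <-> ~ exists c, x = b c.
Hypothesis xiP : forall (N : structure L) (x y : N),
  sat xi [tuple x; y] <-> x = y \/ sat phi [tuple x] /\ sat phi [tuple y].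
Hypotheses (x0b : forall c, b c <> x0) (x1b : forall c, b c <> x1).
Hypothesis x01 : x0 <> x1.

(** Class [ord0] is the infinite one, and class [lift ord0 c] is that of the
    named point [b c]. *)
Definition in_class (a : 'I_m.+1) (x : M) : Prop :=
  if unlift ord0 a is Some c then x = b c else forall c, b c <> x.

(** Two representatives of each class; they are distinct in the infinite
    class, so that all the diagrams of pairs occur between representatives. *)
Definition witness (a : 'I_m.+1) (alpha : 'I_2) : M :=
  if unlift ord0 a is Some c then b c
  else if alpha == ord0 then x0 else x1.

Lemma in_class_witness a alpha : in_class a (witness a alpha).
Proof.
by rewrite /in_class /witness; case: (unlift ord0 a) => // c; case: ifP.
Qed.

Lemma in_class_ex x : exists a, in_class a x.
Proof.
case: (pselect (exists c, x = b c)) => [[c e]|nx].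
  by exists (lift ord0 c); rewrite /in_class liftK.
by exists ord0; rewrite /in_class unlift_none => c e; apply: nx; exists c.
Qed.

Lemma in_class_uniq a a' x : in_class a x -> in_class a' x -> a = a'.
Proof.
rewrite /in_class; case: (unliftP ord0 a) => [c|] ->;
  case: (unliftP ord0 a') => [c'|] -> //.
- by move=> -> /bi ->.
- by move=> e /(_ c); case.
- by move=> h e; case: (h c').
Qed.

Lemma in_class_named a x y : in_class a x -> in_class a y ->
  forall c, x = b c <-> y = b c.
Proof.
rewrite /in_class; case: (unlift ord0 a) => [c -> ->|hx hy] // c.
by split=> e; [case: (hx c)|case: (hy c)].
Qed.

Lemma in_class_xi a x alpha :
  sat xi [tuple x; witness a alpha] <-> in_class a x.
Proof.
have := in_class_witness a alpha; rewrite xiP !bphi /in_class.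
case: (unlift ord0 a) => [c ->|h].
  split=> [[//|[_ h]]|]; [by case: h; exists c|by left].
split=> [[-> //|[nx _]] c e|h']; first by apply: nx; exists c.
by right; split=> -[c e]; [case: (h' c)|case: (h c)].
Qed.

Lemma witness_xi a a' alpha alpha' :
  sat xi [tuple witness a alpha; witness a' alpha'] <-> a = a'.
Proof.
rewrite in_class_xi; split=> [|<-]; last exact: in_class_witness.
by apply: in_class_uniq; exact: in_class_witness.
Qed.

Definition class_diagrams (a a' : 'I_m.+1) : {set diagram L 2} :=
  [set D | [exists alpha, [exists alpha',
     D == atDiag [tuple witness a alpha; witness a' alpha']]]]%SET.

Lemma class_diagramsP a a' D : D \in class_diagrams a a' <->
  exists alpha alpha', D = atDiag [tuple witness a alpha; witness a' alpha'].
Proof.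
rewrite inE; split=> [/existsP [i /existsP [j /eqP ->]]|[i [j ->]]].
  by exists i, j.
by apply/existsP; exists i; apply/existsP; exists j.
Qed.

(** Elements of the same class are equal to the same named points.  So pairs
    from the same two classes are similar as soon as they agree on the equality
    of their entries. *)
Lemma class_diagram_eq a a' x y D : in_class a x -> in_class a' y ->
  D \in class_diagrams a a' -> (inl (ord0, ord_max) \in D <-> x = y) ->
  atDiag [tuple x; y] = D.
Proof.
move=> ax ay /class_diagramsP [i [j ->]]; rewrite atDiag_pair_eq => e.
apply: (atDiag_similar iM iM cb); apply/similar_pair; split=> [|c|c].
- by rewrite e.
- exact: (in_class_named ax (in_class_witness a i)).
- exact: (in_class_named ay (in_class_witness a' j)).
Qed.

(** Equal and distinct pairs are both represented by witnesses; a pair of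
    distinct elements of one class can only come from the infinite class. *)
Lemma class_diagram_mem a a' x y : in_class a x -> in_class a' y ->
  atDiag [tuple x; y] \in class_diagrams a a'.
Proof.
move=> ax ay.
have [j ej] : exists j, x = y <-> witness a ord0 = witness a' j.
  have [e|ne] := pselect (x = y).
    by exists ord0; rewrite (in_class_uniq ax (x := x) (a' := a')) // e.
  exists ord_max; split=> // e; exfalso.
  have := in_class_witness a' ord_max; rewrite -e.
  move=> /(in_class_uniq (in_class_witness a ord0)) ea; subst a'.
  move: ax ay e; rewrite /in_class /witness.
  by case: (unlift ord0 a) => [c xc yc|]; [case: ne; rewrite xc yc|].
apply/class_diagramsP; exists ord0, j.
apply: (atDiag_similar iM iM cb); apply/similar_pair; split=> [//|c|c].
- exact: (in_class_named ax (in_class_witness a _)).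
- exact: (in_class_named ay (in_class_witness a' _)).
Qed.

(** ** Realizing index data by tuples *)

Definition realizes k (d : index_data L m.+1 k) (y : k.-tuple M) : Prop :=
  (forall r s, atDiag [tuple tnth y r; tnth y s] = d.2 r s) /\
  forall r, in_class (d.1 r) (tnth y r).

Local Notation adm := (admissible class_diagrams).

Lemma realizes_admissible k (d : index_data L m.+1 k) y :
  injective (tnth y) -> realizes d y -> adm d.
Proof.
move=> yi [yd yc]; split=> [r s|]; last by exists M, y.
by rewrite -yd; apply: class_diagram_mem.
Qed.

Lemma admissible_eq k (d : index_data L m.+1 k) r s : adm d ->
  inl (ord0, ord_max) \in d.2 r s <-> r = s.
Proof.
case=> _ [N [y [yi yd]]]; rewrite -yd atDiag_pair_eq.
by split=> [/yi|->].
Qed.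

Lemma realizes_inj k (d : index_data L m.+1 k) y : adm d -> realizes d y ->
  injective (tnth y).
Proof.
by move=> ad [yd _] r s /atDiag_pair_eq; rewrite yd => /(admissible_eq _ _ ad).
Qed.

Lemma index_data_ex k (y : k.-tuple M) : exists d, realizes d y.
Proof.
have /choice [cl clP] := in_class_ex.
exists ([ffun r => cl (tnth y r)],
  [ffun r => [ffun s => atDiag [tuple tnth y r; tnth y s]]]).
by split=> [r s|r]; rewrite !ffunE.
Qed.

Lemma realizes_extends k (d : index_data L m.+1 k) (d' : index_data L m.+1 k.+1)
    y z : realizes d y -> realizes d' [tuple of rcons y z] -> extends d d'.
Proof.
move=> [yd yc] [zd zc]; apply/andP; split; apply/forallP => r.
  apply/eqP; apply: in_class_uniq (yc r).
  by have := zc (widen_ord (leqnSn k) r); rewrite tnth_rcons_widen.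
apply/forallP => s; apply/eqP; rewrite -yd -zd.
by rewrite !tnth_rcons_widen.
Qed.

Lemma inj_rcons k (y : k.-tuple M) z : injective (tnth y) ->
  (forall r, tnth y r <> z) -> injective (tnth [tuple of rcons y z]).
Proof.
move=> yi yz i j; case: (ord_lastP i) => [->|[i' ->]];
  case: (ord_lastP j) => [->|[j' ->]];
  rewrite ?tnth_rcons_max ?tnth_rcons_widen //.
- by move/esym/yz.
- by move/yz.
- by move/yi ->.
Qed.

Lemma realizes_next k (d : index_data L m.+1 k) y z :
  injective (tnth y) -> realizes d y -> (forall r, tnth y r <> z) ->
  exists d', [/\ adm d', extends d d' & realizes d' [tuple of rcons y z]].
Proof.
move=> yi dy yz; have [d' d'y] := index_data_ex [tuple of rcons y z].
exists d'; split=> //; last exact: realizes_extends dy d'y.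
exact: realizes_admissible (inj_rcons yi yz) d'y.
Qed.

(** The point added to a realization is fresh if it has to be in the infinite
    class.  If it has to be the named point of a class, then no earlier point
    is in that class, since admissible data describe distinct points. *)
Lemma realizes_extension k (d : index_data L m.+1 k)
    (d' : index_data L m.+1 k.+1) y :
  adm d' -> extends d d' -> injective (tnth y) -> realizes d y ->
  exists z, realizes d' [tuple of rcons y z].
Proof.
move=> ad' /andP [/forallP e1 /forallP e2] yi [yd yc].
pose w := widen_ord (leqnSn k).
have [z zc zy] : exists2 z, in_class (d'.1 ord_max) z & forall r, tnth y r <> z.
  case ea : (unlift ord0 (d'.1 ord_max)) => [c|]; last first.
    have [z hz] := fresh (params b y) iM; exists z.
      by rewrite /in_class ea => c; exact: (hz (inl c)).
    by move=> r; exact: (hz (inr r)).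
  exists (b c); first by rewrite /in_class ea.
  move=> r e.
  have ear : d'.1 (w r) = d'.1 ord_max.
    rewrite (eqP (e1 r)); apply: in_class_uniq (yc r) _.
    by rewrite /in_class ea.
  have : inl (ord0, ord_max) \in d'.2 (w r) ord_max.
    have := ad'.1 (w r) ord_max; rewrite ear => /class_diagramsP [i [j ->]].
    by rewrite atDiag_pair_eq /witness ea.
  move=> /(admissible_eq _ _ ad') /(congr1 val) /= er.
  by have := ltn_ord r; rewrite er ltnn.
exists z; have zi := inj_rcons yi zy.
have zcl i : in_class (d'.1 i) (tnth [tuple of rcons y z] i).
  case: (ord_lastP i) => [->|[r ->]]; first by rewrite tnth_rcons_max.
  by rewrite tnth_rcons_widen (eqP (e1 r)).
split=> // r s; apply: (class_diagram_eq (zcl r) (zcl s) (ad'.1 r s)).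
by rewrite (admissible_eq _ _ ad'); split=> [->|/zi].
Qed.

(** By induction on the number of points, restricting the data to all points but
    the last one. *)
Lemma realizes_ex k (d : index_data L m.+1 k) : adm d -> exists y, realizes d y.
Proof.
elim: k d => [|k IH] d ad; first by exists [tuple]; split=> -[].
pose w := widen_ord (leqnSn k).
pose d0 : index_data L m.+1 k :=
  ([ffun r => d.1 (w r)], [ffun r => [ffun s => d.2 (w r) (w s)]]).
have ad0 : adm d0.
  split=> [r s|]; first by rewrite !ffunE; exact: ad.1.
  have [_ [N [y [yi yd]]]] := ad; exists N, [tuple tnth y (w r) | r < k].
  split=> [r s|r s]; rewrite !tnth_mktuple.
    by move=> /yi /(congr1 val) /= /val_inj.
  by rewrite yd !ffunE.
have [y dy] := IH d0 ad0.
have ext : extends d0 d.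
  apply/andP; split; apply/forallP => r; first by rewrite ffunE.
  by apply/forallP => s; rewrite !ffunE.
by have [z dz] := realizes_extension ad ext (realizes_inj ad0 dy) dy;
  exists [tuple of rcons y z].
Qed.

(** ** The labelling formula *)

Local Notation t := (fun _ : 'I_m.+1 => 1%N).

(** Each class gets two labels, which denote the same point when the class is a
    singleton. *)
Definition labels : (nvars t).-tuple M :=
  [tuple witness (tag (@tagnat.sig m.+1 (fun a => (t a).+1) i))
                 (tagged (@tagnat.sig m.+1 (fun a => (t a).+1) i)) | i < nvars t].

Lemma labelsE a alpha : tnth labels (@xvar m.+1 t a alpha) = witness a alpha.
Proof. by rewrite tnth_mktuple /xvar /tagnat.Rank tagnat.rankK. Qed.

Lemma labels_compatible : compatible (tnth labels) (tnth labels).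
Proof.
split=> // r v w [h k]; apply: cb.2; split=> // i c.
by have := k i (@xvar m.+1 t (lift ord0 c) ord0); rewrite labelsE /witness liftK.
Qed.

(** The first conjunct makes the labels of a model look like those of [M].  The
    diagram and the pattern of [xi] are stated once more because the condition
    on [gamma0] concerns every structure, even a finite one. *)
Lemma label_formula : exists gamma0 : formula L (nvars t),
  [/\ sat gamma0 labels, gamma0_condition xi class_diagrams gamma0 &
      forall (N : structure L) (x : (nvars t).-tuple N),
        infinite_set [set: N] -> sat gamma0 x ->
        compatible (tnth labels) (tnth x)].
Proof.
have [psi [psil psiP]] := definable_compatible hL iM labels_compatible.
pose h (i j : 'I_(nvars t)) (e : 'I_2) := if e == ord0 then i else j.
have hE (N : structure L) (x : (nvars t).-tuple N) i j :
    [tuple tnth x (h i j e) | e < 2] = [tuple tnth x i; tnth x j].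
  by apply: eq_from_tnth; case=> [[|[|//]] ?]; rewrite tnth_mktuple.
have dxi i j : definable (fun (N : structure L) (x : (nvars t).-tuple N) =>
    sat xi [tuple tnth x i; tnth x j] <->
    sat xi [tuple tnth labels i; tnth labels j]).
  have d : definable (fun (N : structure L) (x : (nvars t).-tuple N) =>
      sat xi [tuple tnth x i; tnth x j]).
    apply: (definable_iff (definable_subst (h i j) (definable_sat xi))) => N x.
    by rewrite hE.
  case: (pselect (sat xi [tuple tnth labels i; tnth labels j])) => s.
    by apply: (definable_iff d) => N x; split=> [?|[_]]; [split|apply].
  by apply: (definable_iff (definable_not d)) => N x; split=> [?|[h1 _ /h1]].
have [gamma0 gP] := definable_and (definable_sat psi)
  (definable_and (definable_diag_eq (atDiag labels))
     (definable_forall (fun i => definable_forall (dxi i)))).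
exists gamma0; split.
- by apply/gP.
- move=> N x /gP [_ [ed ex]] a a'.
  have e i j : atDiag [tuple tnth labels i; tnth labels j] =
      atDiag [tuple tnth x i; tnth x j].
    by rewrite -!hE; apply: atDiag_subst.
  split=> [D|alpha beta]; last by rewrite ex !labelsE; exact: witness_xi.
  by rewrite class_diagramsP; split=> -[i [j ->]]; exists i, j;
    rewrite -?e ?labelsE // -!labelsE e.
- by move=> N x iN /gP [sx _]; exact: psiP.
Qed.

(** ** Transfer to an arbitrary model *)

Variable T : theory L.
Hypotheses (cT : complete T) (iT : has_infinite_models T) (TM : is_model T M).

Lemma expresses_realizes k (d : index_data L m.+1 k) theta (y : k.-tuple M) :
  expresses (t := t) xi d theta ->
  sat theta [tuple of labels ++ y] <-> realizes d y.
Proof.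
move=> ex; rewrite ex; split=> -[yd yc]; split=> // r.
  by have := yc r; rewrite labelsE in_class_xi.
by rewrite labelsE; apply/in_class_xi.
Qed.

(** Whatever the labels of [N] are, the formula behaves as in [M] with its own
    labels, once [y'] is matched with a similar tuple of [M]. *)
Lemma expresses_transfer k (d : index_data L m.+1 k) theta (N : structure L)
    (x : (nvars t).-tuple N) (y : k.-tuple M) (y' : k.-tuple N) :
  expresses (t := t) xi d theta -> infinite_set [set: N] ->
  compatible (tnth labels) (tnth x) ->
  similar (tnth labels) (tnth x) (tnth y) (tnth y') ->
  sat theta [tuple of x ++ y'] <-> realizes d y.
Proof.
move=> ex iN cx sim; rewrite -(expresses_realizes y ex).
have := sat_similar theta iM iN cx (similar_cat cx.1 sim); tauto.
Qed.

(** Each clause is moved to [M] by choosing similar tuples, where it becomes a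
    property of realizations of index data, and then moved back. *)
Lemma named_extension_properties :
  (exists k t, k + t = m.+1 /\ restricted_equivalence T xi k t) ->
  xi_Delta_extension_properties T xi class_diagrams.
Proof.
move=> hxi; split=> //.
- move=> a a'; exists (atDiag [tuple witness a ord0; witness a' ord0]).
  by apply/class_diagramsP; exists ord0, ord0.
- by move=> a a' D /class_diagramsP [i [j ->]]; exists M; eexists.
have [gamma0 [gl gc gx]] := label_formula.
exists t, gamma0.
have theta_ex : forall k, exists theta : index_data L m.+1 k -> formula L (nvars t + k),
    forall d, expresses xi d (theta d).
  move=> k; have /choice [th thP] := fun d : index_data L m.+1 k =>
    definable_expresses xi t d.
  by exists th.
pose theta k := projT1 (cid (theta_ex k)).
have thetaP k d : expresses xi d (theta k d) := projT2 (cid (theta_ex k)) d.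
pose A k := [set e : index_data L m.+1 k | `[< adm e >]]%SET.
pose d k (j : 'I_#|A k|) : index_data L m.+1 k := enum_val j.
have dA k j : adm (d k j) by have := enum_valP j; rewrite inE => /asboolP.
have dS k e : adm e -> exists j, d k j = e.
  move=> ae; have eA : e \in A k by rewrite inE; apply/asboolP.
  by exists (enum_rank_in eA e); exact: enum_rankK_in.
exists (fun k => #|A k|), d, (fun k j => theta k (d k j)); split=> //.
  by move=> k _ e; exact: dS.
have satE k (e : index_data L m.+1 k) (N : structure L) (y : k.-tuple N) :=
  sat_extension_axiom gamma0 (theta k e) y.
have iN N : is_model T N -> infinite_set [set: N] := fun TN => infinite_models cT iT TN.
have sat_inj k (e : index_data L m.+1 k) (N : structure L)
    (y : k.-tuple N) : adm e ->
    sat (extension_axiom gamma0 (theta k e)) y -> injective (tnth y).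
  move=> ae /satE [x [_ /thetaP [yd _]]] r s /atDiag_pair_eq.
  by rewrite yd => /(admissible_eq _ _ ae).
have from_real k (e : index_data L m.+1 k) (y : k.-tuple M)
      (N : structure L) (x : (nvars t).-tuple N) (y' : k.-tuple N) :
    is_model T N -> sat gamma0 x ->
    similar (tnth labels) (tnth x) (tnth y) (tnth y') -> realizes e y ->
    sat (extension_axiom gamma0 (theta k e)) y'.
  move=> TN gN sim re; apply/satE; exists x; split=> //.
  exact/(expresses_transfer (thetaP k e) (iN N TN) (gx N x (iN N TN) gN) sim).
have to_real k (e : index_data L m.+1 k) (N : structure L) (y' : k.-tuple N) : is_model T N ->
    sat (extension_axiom gamma0 (theta k e)) y' ->
    exists (x : (nvars t).-tuple N) (y : k.-tuple M), [/\ sat gamma0 x, realizes e y &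
      similar (tnth labels) (tnth x) (tnth y) (tnth y')].
  move=> TN /satE [x [gN th]]; have cx := gx N x (iN N TN) gN.
  have [y sim] := similar_realize y' (compatible_sym cx).1 iM.
  have {}sim := similar_sym sim; exists x, y; split=> //.
  exact/(expresses_transfer (thetaP k e) (iN N TN) cx sim).
have label_ex N : is_model T N -> exists x : (nvars t).-tuple N, sat gamma0 x.
  move=> TN; have [sigma sP] := definable_exists_tuple (definable_sat gamma0).
  have /(complete_transfer cT TM TN) /sP // : sat sigma ([tuple] : 0.-tuple M).
  by apply/sP; exists labels.
have step k (e' : index_data L m.+1 k.+1) (y : k.-tuple M) z (N : structure L)
    (x : (nvars t).-tuple N) (y' : k.-tuple N) : is_model T N -> sat gamma0 x ->
    similar (tnth labels) (tnth x) (tnth y) (tnth y') ->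
    realizes e' [tuple of rcons y z] ->
    exists z', sat (extension_axiom gamma0 (theta k.+1 e')) [tuple of rcons y' z'].
  move=> TN gN sim re; have cx := gx N x (iN N TN) gN.
  have [z' sim'] := similar_rcons z cx.1 (iN N TN) sim.
  by exists z'; exact: from_real sim' re.
split.
- move=> k k0 N TN y' yi; have [x gN] := label_ex N TN.
  have cx := gx N x (iN N TN) gN.
  have [y sim] := similar_realize y' (compatible_sym cx).1 iM.
  have {}sim := similar_sym sim; have [e re] := index_data_ex y.
  have [|j ej] := dS k e; first by apply: realizes_admissible re => r s /sim.1 /yi.
  by exists j; rewrite ej; exact: from_real sim re.
- split=> [k k0 n|j N TN].
    split.
    + have [y re] := realizes_ex (dA k n); have yi := realizes_inj (dA k n) re.
      have [z hz] := fresh (tnth y) iM.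
      have [e' [ae' ext re']] := realizes_next yi re hz.
      by have [j ej] := dS k.+1 e' ae'; exists j; rewrite inE ej.
    + move=> N TN y' /(to_real _ _ _ _ TN) [x [y [gN re sim]]] j.
      rewrite inE => ext.
      have [z re'] := realizes_extension (dA k.+1 j) ext (realizes_inj (dA k n) re) re.
      exact: step TN gN sim re'.
    + move=> N TN y' /(to_real _ _ _ _ TN) [x [y [gN re sim]]] z' hz'.
      have cx := gx N x (iN N TN) gN.
      have [z sim'] := similar_rcons z' (compatible_sym cx).1 iM (similar_sym sim).
      have hz r : tnth y r <> z.
        have := sim'.1 (widen_ord (leqnSn k) r) ord_max.
        rewrite !tnth_rcons_widen !tnth_rcons_max => e /e; exact/nesym/hz'.
      have [e' [ae' ext re']] := realizes_next (realizes_inj (dA k n) re) re hz.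
      have [j ej] := dS k.+1 e' ae'; exists j; rewrite ?inE ej //.
      exact: from_real TN gN (similar_sym sim') re'.
  have [y re] := realizes_ex (dA 1 j); have [x gN] := label_ex N TN.
  have cx := gx N x (iN N TN) gN.
  have [y' sim] := similar_realize y cx.1 (iN N TN); exists (tnth y' ord0).
  rewrite (_ : [tuple tnth y' ord0] = y'); first exact: from_real sim re.
  by apply: eq_from_tnth => i; rewrite !ord1.
- by move=> k k0 n N TN y; exact: sat_inj.
- move=> k k0 n; have [y re] := realizes_ex (dA k n).
  exists (atDiag y); first by exists M, y.
  move=> N TN y' /satE [x [_ /thetaP [yd _]]].
  by apply: atDiag_of_pairs => // r s; rewrite yd re.1.
Qed.

End NamedExtensions.

Lemma extension_properties_of_homogeneous (L : vocabulary) (T : theory L)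
    (M : structure L) (phi : formula L 1) :
  binary L -> complete T -> has_infinite_models T ->
  is_model T M -> homogeneous_model M phi ->
  exists (xi : formula L 2) (t : nat),
    [/\ restricted_equivalence T xi 1 t, xi_extension_properties T xi &
        same_pair_diagrams T xi].
Proof.
move=> hL cT iT TM /(named_points hL cT iT TM) [m [b [bi cb bphi hb]]].
have iM := infinite_models cT iT TM.
have [xi xiP] := named_relation phi; exists xi, m.
have res : restricted_equivalence T xi 1 m.
  move=> N TN; have [b' [_ bi' bphi']] := hb N TN.
  exact: (named_equivalence (infinite_models cT iT TN) bi' bphi' (xiP N)).
split=> //; last first.
  move=> N TN x y x' y'; have [b' [cb' _ bphi']] := hb N TN.
  have iN := infinite_models cT iT TN.
  apply: (same_pair_generic iN bphi' (xiP N)).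
  exact: compatible_trans iM (compatible_sym cb') cb'.
have [x0 x0b] := fresh b iM.
have [x1 hx1] := fresh (fun z : 'I_m + unit => if z is inl c then b c else x0) iM.
exists m.+1, (class_diagrams b x0 x1).
apply: (named_extension_properties hL iM bi cb bphi xiP x0b _ _ cT iT TM).
- by move=> c; exact: (hx1 (inl c)).
- exact: (hx1 (inr tt)).
- by exists 1, m.
Qed.

(** * Extension properties over base sets *)

Lemma card_eq1_uniq (A : Type) (S : set A) x y : S #= `I_1 -> S x -> S y -> x = y.
Proof.
move=> /card_set_bijP [f [fS fi _]] Sx Sy; apply: fi; rewrite ?inE //.
by have := fS x Sx; have := fS y Sy; rewrite /= !ltnS !leqn0 => /eqP -> /eqP ->.
Qed.

Section BaseSets.

Variables (L : vocabulary) (T : theory L) (M : structure L).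
Variables (xi : formula L 2) (t : nat).
Hypotheses (TM : is_model T M) (iM : infinite_set [set: M]).
Hypothesis res : restricted_equivalence T xi 1 t.
Hypothesis same : same_pair_diagrams T xi.

Local Notation base := (@in_base_set L M xi).

Lemma xi_refl (x : M) : sat xi [tuple x; x].
Proof. by have [[r _ _] _ _ _] := res TM; exact: r. Qed.

Lemma xi_sym (x y : M) : sat xi [tuple x; y] -> sat xi [tuple y; x].
Proof. by have [[_ s _] _ _ _] := res TM; exact: s. Qed.

Lemma xi_trans (x y z : M) :
  sat xi [tuple x; y] -> sat xi [tuple y; z] -> sat xi [tuple x; z].
Proof. by have [[_ _ s] _ _ _] := res TM; exact: s. Qed.

Lemma base_xi (x y : M) : base x -> sat xi [tuple x; y] -> y = x.
Proof. by move=> bx h; have : eqclass xi x y := h; rewrite bx. Qed.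

Lemma baseP (x : M) : base x <-> forall y, sat xi [tuple x; y] -> y = x.
Proof.
split=> [bx y|h]; first exact: base_xi.
by apply/seteqP; split=> [y /h|y ->] //; exact: xi_refl.
Qed.

Lemma generic_infinite (x : M) : ~ base x -> infinite_set (eqclass xi x).
Proof.
have [_ dich _ _] := res TM; have [|//|[a ea]] := dich (eqclass xi x); first by exists x.
by case; rewrite /in_base_set ea; have : eqclass xi x x := xi_refl x; rewrite ea => <-.
Qed.

Lemma generic_xi (x y : M) : ~ base x -> ~ base y -> sat xi [tuple x; y].
Proof.
move=> nx ny; have [_ _ one _] := res TM.
have e : eqclass xi x = eqclass xi y.
  by apply: (card_eq1_uniq one); split;
    [exists x|exact: generic_infinite|exists y|exact: generic_infinite].
by have : eqclass xi y y := xi_refl y; rewrite -e.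
Qed.

Lemma finite_base : finite_set [set x | base x].
Proof.
have [_ _ _ sing] := res TM.
set S := [set C | _] in sing.
have fS : finite_set S by exists t.
have bS (x : M) : S (eqclass xi x) -> eqclass xi x = [set x].
  by case=> _ [a ea]; have : eqclass xi x x := xi_refl x; rewrite ea => ->.
apply: sub_finite_set (finite_preimage (f := @eqclass L M xi) _ fS).
  by move=> x bx; split; [exists x|exists x].
move=> x y; rewrite !inE => /bS ex /bS ey; rewrite ex ey => /seteqP [h _].
exact: h x erefl.
Qed.

Lemma generic_self (x y : M) : ~ base x -> ~ base y ->
  atDiag [tuple x; x] = atDiag [tuple y; y].
Proof.
move=> nx ny; have ig := infinite_setD iM finite_base.
have [z [_ nz] hz] := fresh_in (tnth [tuple x; y]) ig.
apply: (@atDiag_diag _ _ _ _ z _ z); apply: same => //.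
- exact: (hz ord0).
- exact: (hz ord_max).
Qed.

(** ** Labellings *)

Variables (l : nat) (Delta : 'I_l.+1 -> 'I_l.+1 -> {set diagram L 2}).
Variables (tt : 'I_l.+1 -> nat) (gamma0 : formula L (nvars tt)).
Variables (i : nat -> nat) (d : forall k, 'I_(i k) -> index_data L l.+1 k).
Variable theta : forall k, 'I_(i k) -> formula L (nvars tt + k).
Arguments d [k] _.
Arguments theta [k] _.
Hypothesis gamma0P : gamma0_condition xi Delta gamma0.
Hypothesis dP : forall k, 0 < k -> forall j : 'I_(i k),
  admissible Delta (d j) /\ expresses xi (d j) (theta j).
Hypothesis dS : forall k, 0 < k -> forall e : index_data L l.+1 k,
  admissible Delta e -> exists j : 'I_(i k), d j = e.
Hypothesis ext : extension_properties T
  (fun k j => extension_axiom gamma0 (@theta k j))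
  (fun k j => [set j' | extends (@d k j) (@d k.+1 j')]%SET).

Definition label (u : (nvars tt).-tuple M) (a : 'I_l.+1) : M :=
  tnth u (@xvar l.+1 tt a ord0).

Lemma label_xi u a a' : sat gamma0 u ->
  sat xi [tuple label u a; label u a'] <-> a = a'.
Proof. by move=> gu; have [_ h] := gamma0P gu a a'; exact: h. Qed.

Lemma label_diagram u a a' : sat gamma0 u ->
  atDiag [tuple label u a; label u a'] \in Delta a a'.
Proof. by move=> gu; apply/((gamma0P gu a a').1 _); exists ord0, ord0. Qed.

Lemma realized k (y : k.-tuple M) : 0 < k -> injective (tnth y) ->
  exists (u : (nvars tt).-tuple M) (e : index_data L l.+1 k),
    [/\ sat gamma0 u, admissible Delta e,
        forall r s, atDiag [tuple tnth y r; tnth y s] = e.2 r s &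
        forall r, sat xi [tuple tnth y r; label u (e.1 r)]].
Proof.
move=> k0 yi; have [h1 _ _ _] := ext; have [n] := h1 k k0 M TM y yi.
move=> /sat_extension_axiom [u [gu]]; have [ad ex] := dP k0 n.
by move=> /ex [yd yc]; exists u, (d n).
Qed.

(** Representatives of [l.+2] classes would be given [l.+1] class indices. *)
Lemma label_cover u y : sat gamma0 u -> exists a, sat xi [tuple y; label u a].
Proof.
move=> gu; apply: contrapT => ny.
pose Y := [tuple of rcons [tuple label u a | a < l.+1] y].
have Yxi r s : sat xi [tuple tnth Y r; tnth Y s] -> r = s.
  case: (ord_lastP r) => [->|[r' ->]]; case: (ord_lastP s) => [->|[s' ->]] //;
    rewrite ?tnth_rcons_max ?tnth_rcons_widen ?tnth_mktuple.
  - by move=> h; case: ny; exists s'.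
  - by move=> /xi_sym h; case: ny; exists r'.
  - by move=> /(label_xi _ _ gu) ->.
have Yi : injective (tnth Y) by move=> r s e; apply: Yxi; rewrite e; exact: xi_refl.
have [//|w [e [gw _ _ wc]]] := realized _ Yi.
have /leq_card : injective (e.1 : 'I_l.+2 -> 'I_l.+1).
  move=> r s ers; apply: Yxi; apply: xi_trans (wc r) _; rewrite ers.
  exact: xi_sym.
by rewrite !card_ord ltnn.
Qed.

(** The index of the infinite class does not depend on the labelling: it is
    the one that allows two distinct elements. *)
Lemma label_generic u a D : sat gamma0 u ->
  D \in Delta a a -> inl (ord0, ord_max) \notin D -> ~ base (label u a).
Proof.
move=> gu DD nD bu; have [h1 h2] := gamma0P gu a a.
have /h1 [al [be eD]] := DD.
have hal := base_xi bu ((h2 ord0 al).2 erefl).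
have hbe := base_xi bu ((h2 ord0 be).2 erefl).
by move/negP: nD; apply; rewrite eD hal hbe; apply/atDiag_pair_eq.
Qed.

(** Different labels are in different classes, and only one class is infinite. *)
Lemma label_base u a a' : sat gamma0 u -> ~ base (label u a) -> a' <> a ->
  base (label u a').
Proof.
move=> gu na ne; apply: contrapT => na'; apply: ne.
by apply/(label_xi _ _ gu)/generic_xi.
Qed.

(** ** Diagrams with base elements *)

Section OneBaseElement.

Variables (u : (nvars tt).-tuple M) (g a : 'I_l.+1) (x : M).
Variable D : diagram L 2.
Hypotheses (gu : sat gamma0 u) (ag : a <> g) (nx : ~ base x).
Hypotheses (DD : D \in Delta g g) (nD : inl (ord0, ord_max) \notin D).
Hypothesis xD : atDiag [tuple x; label u a] \in Delta g a.

Let ng : ~ base (label u g) := label_generic gu DD nD.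

Let ba a' : a' <> g -> base (label u a') := label_base gu ng.

Definition relabel (a' : 'I_l.+1) : M := if a' == g then x else label u a'.

(** The labels, with the representative of the infinite class replaced by [x],
    but only as seen from the base element of index [a]. *)
Definition modified : structure L :=
  @Structure L 'I_l.+1
    (fun r v => interp M r [tuple of map
       (if a \in (v : seq 'I_l.+1) then relabel else label u) v])
    (inhabits a).

Lemma label_inj : injective (label u).
Proof. by move=> p q e; apply/(label_xi _ _ gu); rewrite e; exact: xi_refl. Qed.

Lemma relabel_inj : injective relabel.
Proof.
move=> p q; rewrite /relabel.
case: eqP => [->|np]; case: eqP => [->|nq] // e.
- by case: nx; rewrite e; exact: ba.
- by case: nx; rewrite -e; exact: ba.
- exact: label_inj e.
Qed.

Lemma relabel_self p :
  atDiag [tuple label u p; label u p] = atDiag [tuple relabel p; relabel p].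
Proof. by rewrite /relabel; case: (p =P g) => [->|//]; exact: generic_self. Qed.

(** A relation tuple over a pair involving [a] which avoids [a] itself is
    constant, and [relabel_self] makes the two labellings agree on it. *)
Lemma modified_diagram (p q : modified) :
  atDiag [tuple p; q] =
  if (p == a :> 'I_l.+1) || (q == a :> 'I_l.+1)
  then atDiag [tuple relabel p; relabel q]
  else atDiag [tuple label u p; label u q].
Proof.
pose W := if (p == a :> 'I_l.+1) || (q == a :> 'I_l.+1) then relabel else label u.
rewrite (_ : (if _ then _ else _) = atDiag [tuple W p; W q]); last by rewrite /W; case: ifP.
have Wi : injective W by rewrite /W; case: ifP => _; [exact: relabel_inj|exact: label_inj].
have Wt j : tnth [tuple W p; W q] j = W (tnth [tuple p; q] j).
  by case: j => -[|[|//]] ?.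
apply/atDiag_eqP => -[[j j']|[r w]].
  by rewrite /sat_atomic !Wt; split=> [->|/Wi].
rewrite /sat_atomic; set v := [tuple of map (tnth [tuple p; q]) w].
have -> : [tuple of map (tnth [tuple W p; W q]) w] = [tuple of map W v].
  by apply: eq_from_tnth => j; rewrite !tnth_map Wt.
rewrite /=; case: ifP => av.
  rewrite /W; case: ifP => // /norP [pa qa].
  case/mapP: av => j _ ej; move: pa qa; rewrite ej.
  by case: j {ej} => -[|[|//]] ? /=; rewrite !(tnth_nth p) /= eqxx.
rewrite /W; case: ifP => // pq.
pose e : 'I_l.+1 := if p == a :> 'I_l.+1 then q else p.
have ve j : tnth v j = e.
  have : tnth v j <> a by move=> h; move/negP: av; apply; rewrite -h; exact: mem_tnth.
  rewrite tnth_map; move: pq; rewrite /e.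
  case: (tnth w j) => -[|[|//]] ?; rewrite !(tnth_nth p) /=.
    by case: eqP.
  by case: eqP => //= _ /eqP.
have /atDiag_eqP /(_ (inr (existT _ r w))) := relabel_self e.
rewrite /sat_atomic.
have eF (F : 'I_l.+1 -> M) :
    [tuple of map (tnth [tuple F e; F e]) w] = [tuple of map F v].
  apply: eq_from_tnth => j; rewrite [RHS]tnth_map ve tnth_map.
  by case: (tnth w j) => -[|[|//]] ?.
by rewrite !eF.
Qed.

Lemma modified_Delta (p q : modified) : atDiag [tuple p; q] \in Delta p q.
Proof.
rewrite modified_diagram; case: ifP => [|_]; last exact: label_diagram.
rewrite /relabel; case: (eqVneq p g) => [->|pg]; case: (eqVneq q g) => [->|qg].
- by case/orP => /eqP e; case: ag.
- case/orP => /eqP e; first by case: ag.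
  by rewrite e.
- case/orP => /eqP e; last by case: ag.
  rewrite e; have [h _] := gamma0P gu g a.
  have /h [al [be eD]] := xD.
  by apply/((gamma0P gu a g).1 _); exists be, al; exact: atDiag_flip eD.
- by move=> _; exact: label_diagram.
Qed.

(** The tuple [y] consists of all the labels but that of [a].  The data [e]
    extend its data by a point of class [a] which has with the representative
    [label u g] the diagram of [x] instead of its own; the modified structure
    shows that these data are consistent.  The extension axiom yields a point
    [z] realizing them.  As [z] is a base element, possibly under another
    labelling, and differs from the base elements in [y], it can only be
    [label u a], which has the diagram of [x] after all. *)
Lemma base_diagram : atDiag [tuple label u g; label u a] = atDiag [tuple x; label u a].
Proof.
have l0 : 0 < l.
  move: (g) (a) ag; case: l => // p q; by rewrite !ord1.
have Vw s : lift ord_max s = widen_ord (leqnSn l) s.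
  by apply: val_inj; exact: lift_max.
pose c (r : 'I_l.+1) : modified := if unlift ord_max r is Some s then lift a s else a.
have cm : c ord_max = a by rewrite /c unlift_none.
have cw s : c (widen_ord (leqnSn l) s) = lift a s by rewrite -Vw /c liftK.
have ci : injective c.
  move=> r s; case: (ord_lastP r) => [->|[r' ->]]; case: (ord_lastP s) => [->|[s' ->]];
    rewrite ?cm ?cw //.
  - by move=> /eqP; rewrite (negPf (neq_lift _ _)).
  - by move=> /esym/eqP; rewrite (negPf (neq_lift _ _)).
  - by move=> /lift_inj ->.
pose e : index_data L l.+1 l.+1 := ([ffun r => (c r : 'I_l.+1)],
  [ffun r => [ffun s => atDiag [tuple c r; c s]]]).
have ae : admissible Delta e.
  split=> [r s|]; first by rewrite !ffunE; exact: modified_Delta.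
  exists modified, [tuple c r | r < l.+1]; split=> [r s|r s]; rewrite !tnth_mktuple.
    exact: ci.
  by rewrite !ffunE.
pose y := [tuple label u (lift a s) | s < l].
have yi : injective (tnth y).
  by move=> r s; rewrite !tnth_mktuple => /label_inj /lift_inj.
pose e0 : index_data L l.+1 l := ([ffun s => lift a s],
  [ffun r => [ffun s => atDiag [tuple tnth y r; tnth y s]]]).
have ae0 : admissible Delta e0.
  split=> [r s|]; first by rewrite !ffunE !tnth_mktuple; exact: label_diagram.
  by exists M, y; split=> // r s; rewrite !ffunE.
have [j0 ej0] := dS l0 ae0; have [j1 ej1] := dS (ltn0Sn l) ae.
have ext01 : extends (d j0) (d j1).
  rewrite ej0 ej1; apply/andP; split; apply/forallP => r; first by rewrite !ffunE cw.
  apply/forallP => s; rewrite !ffunE !cw modified_diagram !tnth_mktuple.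
  by rewrite ![lift a _ == a]eq_sym !(negPf (neq_lift _ _)).
have sy : sat (extension_axiom gamma0 (theta j0)) y.
  apply/sat_extension_axiom; exists u; split=> //.
  apply/((dP l0 j0).2 M u y); rewrite ej0; split=> [r s|r]; first by rewrite !ffunE.
  by rewrite ffunE tnth_mktuple; exact: xi_refl.
have [_ [E2 _] E3 _] := ext.
have [_ E2b _] := E2 l l0 j0.
have [|z sz] := E2b M TM y sy j1; first by rewrite inE.
have zi := E3 l.+1 (ltn0Sn l) j1 M TM _ sz.
case/sat_extension_axiom: sz => w [gw /((dP (ltn0Sn l) j1).2)].
rewrite ej1 => -[zd zc].
have bz : base z.
  have := zc ord_max; rewrite tnth_rcons_max ffunE cm => /xi_sym h.
  have bw := label_base gw (label_generic gw DD nD) ag.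
  by rewrite (base_xi bw h).
have ez : z = label u a.
  have [a' ha'] := label_cover z gu; have {ha'} ha' := base_xi bz ha'.
  rewrite -ha'; congr (label u _); apply: contrapT => /eqP.
  rewrite eq_sym => /unlift_some [s es _].
  have : tnth [tuple of rcons y z] (widen_ord (leqnSn l) s) =
      tnth [tuple of rcons y z] ord_max.
    by rewrite tnth_rcons_widen tnth_rcons_max tnth_mktuple -es.
  by move=> /zi /(congr1 val) /= es'; have := ltn_ord s; rewrite es' ltnn.
have /unlift_some [s es _] : a != g by exact/eqP.
have := zd (widen_ord (leqnSn l) s) ord_max.
rewrite tnth_rcons_widen tnth_rcons_max tnth_mktuple !ffunE cm cw -es ez.
rewrite modified_diagram eqxx orbT /relabel eqxx.
by case: (a =P g).
Qed.

End OneBaseElement.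

(** The diagrams of [x] and [x'] with [b] are both allowed for one labelling,
    namely one that serves the triple.  So [base_diagram] identifies both with
    the diagram of the label of the infinite class. *)
Lemma base_homogeneous (x x' b : M) : base b -> ~ base x -> ~ base x' ->
  atDiag [tuple x; b] = atDiag [tuple x'; b].
Proof.
move=> bb nx nx'; have [->//|ne] := pselect (x = x').
pose y := [tuple x; x'; b].
have neb (z : M) : ~ base z -> z <> b by move=> nz e; rewrite e in nz.
have yi : injective (tnth y).
  case=> [[|[|[|//]]] ?] [[|[|[|//]]] ?]; rewrite !(tnth_nth x) /= => h;
    apply: val_inj => //=.
  - by case: (neb x nx).
  - by case: ne.
  - by case: (neb x' nx').
  - by case: (neb x nx).
  - by case: (neb x' nx').
have [//|u [e [gu [ed _] yd yc]]] := realized _ yi.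
pose o0 : 'I_3 := @Ordinal 3 0 isT; pose o1 : 'I_3 := @Ordinal 3 1 isT.
pose o2 : 'I_3 := @Ordinal 3 2 isT.
have e10 : e.1 o1 = e.1 o0.
  apply/(label_xi _ _ gu); apply: xi_trans (xi_sym (yc o1)) _.
  by apply: xi_trans (yc o0); exact: generic_xi.
have eb : label u (e.1 o2) = b by exact: base_xi bb (yc o2).
have DD : atDiag [tuple x; x'] \in Delta (e.1 o0) (e.1 o0).
  by rewrite -{2}e10; have := ed o0 o1; rewrite -yd.
have nD : inl (ord0, ord_max) \notin atDiag [tuple x; x'].
  by apply/negP => /atDiag_pair_eq.
have ag : e.1 o2 <> e.1 o0.
  by move=> h; have := label_generic gu DD nD; rewrite -h eb.
have := @base_diagram u (e.1 o0) (e.1 o2) x _ gu ag nx DD nD.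
have := @base_diagram u (e.1 o0) (e.1 o2) x' _ gu ag nx' DD nD.
rewrite eb => h' h; rewrite -h; first rewrite -h' //.
- by rewrite -e10; have := ed o1 o2; rewrite -yd.
- by have := ed o0 o2; rewrite -yd.
Qed.

End BaseSets.

Lemma base_definable (L : vocabulary) (xi : formula L 2) :
  exists phi : formula L 1, forall (M : structure L) (x : M),
    sat phi [tuple x] <-> ~ forall y, sat xi [tuple x; y] -> y = x.
Proof.
pose h (j : 'I_2) : 'I_2 := if j == ord0 then ord_max else ord0.
have [phi phiP] := definable_not (definable_all (definable_or
  (definable_not (definable_subst h (definable_sat xi)))
  (definable_sat (Atom (L := L) (inl (ord0 : 'I_2, ord_max)))))).
exists phi => M x; rewrite phiP.
have e (y : M) : [tuple tnth [tuple of y :: [tuple x]] (h j) | j < 2] = [tuple x; y].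
  by apply: eq_from_tnth; case=> [[|[|//]] ?]; rewrite tnth_mktuple.
split=> hx hy; apply: hx => y.
  by case: (pselect (sat xi [tuple x; y])) => [/hy|]; [right|left; rewrite e].
by case: (hy y) => [|h1 _ //]; rewrite e.
Qed.

Lemma homogeneous_of_extension_properties (L : vocabulary) (T : theory L)
    (M : structure L) (xi : formula L 2) (t : nat) :
  complete T -> has_infinite_models T -> is_model T M ->
  restricted_equivalence T xi 1 t -> xi_extension_properties T xi ->
  same_pair_diagrams T xi -> exists phi, homogeneous_model M phi.
Proof.
move=> cT iT TM res [l [Delta [_ _ _ [tt [gamma0 [i [d [theta [gP dP dS ext]]]]]]]]] same.
have iM := infinite_models cT iT TM.
have [phi phiP] := base_definable xi; exists phi; rewrite /homogeneous_model.
have -> : ~` defset phi ([tuple] : 0.-tuple M) = [set x | in_base_set xi x].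
  rewrite defset0E; apply/seteqP; split=> x /=; rewrite phiP (baseP TM res).
    exact: contrapT.
  by move=> h; apply.
split; first exact: finite_base TM res.
(* Without classes there is no index for the class of a point. *)
case: l => [|l] in Delta tt gamma0 d theta gP dP dS ext *.
  have [x] := structure_inhabited M; have [h _ _ _] := ext.
  have [|n /sat_extension_axiom [u [_ /((dP 1 isT n).2) _]]] := h 1 isT M TM [tuple x].
    by move=> r s _; rewrite !ord1.
  by case: ((d 1 n).1 ord0).
have baseH := base_homogeneous TM iM res same gP dP dS ext.
have agree (x y : M) : (in_base_set xi x \/ in_base_set xi y -> x = y) ->
    ~ in_base_set xi x -> ~ in_base_set xi y.
  by move=> h nx by_; apply: nx; rewrite h //; right.
move=> p q p' q' e hp hq.
have [ap|np] := pselect (in_base_set xi p); have [aq|nq] := pselect (in_base_set xi q).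
- by rewrite hp; [rewrite hq; [|left]|left].
- rewrite -hp; last by left.
  by apply/atDiag_flip/baseH => //; exact: agree hq nq.
- rewrite -hq; last by left.
  by apply: baseH => //; exact: agree hp np.
have np' := agree _ _ hp np; have nq' := agree _ _ hq nq.
have [epq|npq] := pselect (p = q).
  by rewrite -epq -(e.1 epq); exact: (generic_self TM iM res same).
by apply: same => // /e.
Qed.

(** * The equivalence *)

Theorem corollary5p12 (L : vocabulary) (hL : binary L) (T : theory L)
    (hT : complete T) (hinf : has_infinite_models T) :
  [<-> (* (i) *)
       [/\ strongly_minimal T, omega_categorical T & trivial_acl T];
       (* (ii) *)
       exists (xi : formula L 2) (t : nat),
         [/\ restricted_equivalence T xi 1 t,
             xi_extension_properties T xi &
             same_pair_diagrams T xi];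
       (* (iii) *)
       forall M : structure L, is_model T M ->
         exists phi : formula L 1,
           let X := defset phi ([tuple] : 0.-tuple M) in
           finite_set (~` X) /\ indiscernible_over X (~` X)].
Proof.
tfae.
- move=> [smT catT triv]; have [M [TM iM]] := hinf.
  have [phi hM] := minimal_homogeneous hT hinf smT catT triv TM.
  exact: extension_properties_of_homogeneous hL hT hinf TM hM.
- move=> [xi [t [res ext same]]] N; have [M [TM iM]] := hinf.
  have [phi hM] := homogeneous_of_extension_properties hT hinf TM res ext same.
  exact: indiscernible_of_homogeneous hL hT hinf TM hM N.
- move=> ind; have [M [TM iM]] := hinf; have [phi [fX iX]] := ind M TM.
  have hM := homogeneous_of_indiscernible fX iX.
  exact: minimal_categorical_trivial_of_homogeneous hL hT hinf TM hM.
Qed.
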